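(* Let $f:(0,\infty)\to(0,1]$ be a function that decreases to zero and is regularly varying at infinity with index of regular variation $-\gamma$, where $\gamma\in[0,1)$. Let $\omega_t$ be the clique number of the random multigraph $G_t(f)$. Then for every $\delta\in(0,1)$ there exist positive constants $c_1,c_2,c_3$ depending on $\delta$ only ($f$ being fixed) such that for all integers $t\ge2$ $$ \mathbb{P}\left(c_1t^{(1-\gamma)(1-\delta)/2}\le\omega_t\le c_2t^{(1-\gamma)(1+\delta)/2}\right)\ge 1-\frac{c_3}{\log t}. $$
   Context: Multigraphs may have loops and multiple edges; a loop contributes 2 to the degree of its vertex. For a finite connected multigraph $G$, $\pi_G$ is the probability distribution on its vertices $\pi_G(v)=\deg(v)/\sum_{w\in G}\deg(w)$. Process $G_t(f)$: let $(Z_t)_{t\ge1}$ be independent with $Z_t\sim\mathrm{Ber}(f(t))$. $G_0$ is one vertex with one self-loop. Given $G_t$ and independently of the past: if $Z_{t+1}=1$ (vertex-step), add a new vertex and connect it by one edge to a vertex of $G_t$ chosen according to $\pi_{G_t}$; if $Z_{t+1}=0$ (edge-step), add a new edge between two vertices of $G_t$ chosen independently, each according to $\pi_{G_t}$ (possibly creating a loop or a multiple edge). The result is $G_{t+1}$. The clique number of a multigraph is the largest size of a set of pairwise adjacent vertices. A function $f:(0,\infty)\to(0,\infty)$ is regularly varying at infinity with index $\beta\in\mathbb{R}$ if $\lim_{t\to\infty}f(at)/f(t)=a^{\beta}$ for all $a>0$. *)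

(* Defs.v *)
From HB Require Import structures.
From mathcomp Require Import all_boot all_order all_algebra.
From mathcomp Require Import all_classical all_reals all_analysis.
Set Implicit Arguments.
Unset Strict Implicit.
Unset Printing Implicit Defensive.
Import Order.TTheory GRing.Theory Num.Theory.
Import numFieldNormedType.Exports.
Local Open Scope classical_set_scope.
Local Open Scope ring_scope.

(* The vertices of a finite multigraph are 'I_n, in order of arrival; its edges
   are listed, with repetition, in order of arrival.  The orientation of the
   pair representing an edge is irrelevant to deg and adjacent. *)
Definition mgraph := {n : nat & seq ('I_n * 'I_n)}.

Definition mkgraph (n : nat) (s : seq ('I_n * 'I_n)) : mgraph :=
  existT (fun n => seq ('I_n * 'I_n)) n s.

Definition nvert (g : mgraph) : nat := projT1 g.
Definition edges (g : mgraph) : seq ('I_(nvert g) * 'I_(nvert g)) := projT2 g.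

HB.instance Definition _ := Countable.on mgraph.
HB.instance Definition _ := isPointed.Build mgraph (@mkgraph 0 [::]).
HB.instance Definition _ := @isMeasurable.Build default_measure_display
  mgraph discrete_measurable discrete_measurable0
  discrete_measurableC discrete_measurableU.

(* Both ends are counted, so that a loop contributes 2. *)
Definition deg (g : mgraph) (v : 'I_(nvert g)) : nat :=
  (count (fun e => e.1 == v) (edges g) + count (fun e => e.2 == v) (edges g))%N.

Definition pi_deg (R : realType) (g : mgraph) (v : 'I_(nvert g)) : R :=
  (deg v)%:R / (\sum_(w < nvert g) deg w)%N%:R.

Definition adjacent (g : mgraph) (u v : 'I_(nvert g)) : bool :=
  ((u, v) \in edges g) || ((v, u) \in edges g).

Definition is_clique (g : mgraph) (A : {set 'I_(nvert g)}) : bool :=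
  [forall u in A, forall v in A, (u != v) ==> adjacent u v].

Definition clique_number (g : mgraph) : nat :=
  \max_(A : {set 'I_(nvert g)} | is_clique A) #|A|.

Definition loop_graph : mgraph := @mkgraph 1 [:: (ord0, ord0)].

Definition add_vertex (g : mgraph) (v : 'I_(nvert g)) : mgraph :=
  let w := widen_ord (leqnSn (nvert g)) in
  @mkgraph (nvert g).+1
    (rcons [seq (w e.1, w e.2) | e <- edges g] (ord_max, w v)).

Definition add_edge (g : mgraph) (u v : 'I_(nvert g)) : mgraph :=
  mkgraph (rcons (edges g) (u, v)).

(* The probability that the next graph is h, given that the current one is g
   and that the next step is a vertex-step (b = true) or an edge-step. *)
Definition step_prob (R : realType) (b : bool) (g h : mgraph) : R :=
  if b then
    \sum_(v < nvert g) pi_deg R v * (add_vertex v == h)%:R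
  else
    \sum_(u < nvert g) \sum_(v < nvert g)
      pi_deg R u * pi_deg R v * (add_edge u v == h)%:R.

(* The event Z_1 = z_1, ..., Z_t = z_t, G_0 = g_0, ..., G_t = g_t. *)
Definition history (T : Type) (Z : nat -> T -> bool) (G : nat -> T -> mgraph)
    (z : nat -> bool) (g : nat -> mgraph) (t : nat) : set T :=
  [set w | (forall s, (1 <= s <= t)%N -> Z s w = z s) /\
           (forall s, (s <= t)%N -> G s w = g s)].

(* Z 0 plays no role.  Since the events history Z G z g t, for varying z and g,
   form a countable partition, esp_indep says that Z_(t+1) is independent of
   (Z_1, ..., Z_t, G_0, ..., G_t); in particular the Z_t are mutually
   independent.  The conditional law of G_(t+1) in esp_step is written in
   product form, which makes sense for histories of probability 0 too. *)
Record edge_step_process (R : realType) (f : R -> R) (d : measure_display)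
    (T : measurableType d) (P : probability T R)
    (Z : nat -> {RV P >-> bool}) (G : nat -> {RV P >-> mgraph}) : Prop := {
  esp_start : forall w, G 0%N w = loop_graph;
  esp_bernoulli : forall t : nat, (1 <= t)%N ->
    P (Z t @^-1` [set true]) = (f t%:R)%:E;
  esp_indep : forall (t : nat) (z : nat -> bool) (g : nat -> mgraph) (b : bool),
    P (history Z G z g t `&` Z t.+1 @^-1` [set b]) =
    (P (history Z G z g t) * P (Z t.+1 @^-1` [set b]))%E;
  esp_step : forall (t : nat) (z : nat -> bool) (g : nat -> mgraph) (b : bool)
      (h : mgraph),
    P (history Z G z g t `&` Z t.+1 @^-1` [set b] `&` G t.+1 @^-1` [set h]) =
    (P (history Z G z g t `&` Z t.+1 @^-1` [set b]) *
     (step_prob R b (g t) h)%:E)%E }.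

(* Functions on the positive half-line are represented by functions on R whose
   values at nonpositive arguments are ignored. *)
Definition regularly_varying (R : realType) (f : R -> R) (beta : R) : Prop :=
  (forall x : R, 0 < x -> 0 < f x) /\
  (forall a : R, 0 < a -> f (a * t) / f t @[t --> +oo] --> a `^ beta).

Definition decreases_to_zero (R : realType) (f : R -> R) : Prop :=
  (forall x y : R, 0 < x -> x <= y -> f y <= f x) /\ f t @[t --> +oo] --> (0 : R).

(* Main.v *)
(** The clique number is about the square root of the number of vertices because
two vertices born at times r and s are likely to be adjacent at time t exactly
when r s is much smaller than t.

Upper bound: a clique of G_t consists of vertices born before time m, of which
there are about m ^ (1 - gamma), and of vertices born after m.  The late part has
size at most the square root of twice the number of edges between late vertices,
and the first two moments of their total degree show that the expected number of
such edges is O(t Theta ^ 2), where Theta is the sum of f(s) / s for m < s <= t.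
Take m = sqrt t and apply Markov's inequality.

Lower bound: take m slightly smaller than sqrt t.  By Chebyshev's inequality G_m
has enough vertices.  The sum over these vertices of phi(deg v), with phi(D) of
order D ^ (-1/2), decreases in mean like u ^ (-1/2 + o(1)), so at time t / 2 at
least half of them have degree t ^ (1 - o(1)) / m.  Two such vertices are then
joined at each later edge-step with probability at least t ^ (- o(1)) / m ^ 2, and
with high probability all pairs are joined by time t.

The powers of t are compared by means of Potter's bounds for f. *)
Require Import Defs.
From mathcomp Require Import all_boot all_order all_algebra.
From mathcomp Require Import all_classical all_reals all_analysis.
From mathcomp Require Import zify ring lra.
Set Implicit Arguments.
Unset Strict Implicit.
Unset Printing Implicit Defensive.
Import Order.TTheory GRing.Theory Num.Theory.
Import numFieldNormedType.Exports.
Local Open Scope ring_scope.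

(** * Degrees and edges through the natural-number labels of the vertices *)

(** The vertex type ['I_(nvert g)] changes at each vertex-step; with plain numbers as labels a
    vertex keeps its name in all later graphs. *)
Definition nedges (g : mgraph) : seq (nat * nat) :=
  [seq (val e.1, val e.2) | e <- edges g].

(** The total degree of [p], see [sum_deg]. Counting edge ends makes the effect of a step visible,
    and [p] may contain labels of vertices not yet born. *)
Definition hits (p : pred nat) (g : mgraph) : nat :=
  (count (fun e => p e.1) (nedges g) + count (fun e => p e.2) (nedges g))%N.

Definition degn (g : mgraph) (i : nat) : nat := hits (pred1 i) g.

Lemma nedges_add_vertex (g : mgraph) (v : 'I_(nvert g)) :
  nedges (add_vertex v) = rcons (nedges g) (nvert g, val v).
Proof.
by rewrite /nedges /add_vertex /= map_rcons /= -map_comp.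
Qed.

Lemma nedges_add_edge (g : mgraph) (u v : 'I_(nvert g)) :
  nedges (add_edge u v) = rcons (nedges g) (val u, val v).
Proof. by rewrite /nedges /add_edge /= map_rcons. Qed.

Lemma hits_add_vertex p (g : mgraph) (v : 'I_(nvert g)) :
  hits p (add_vertex v) = (hits p g + p (nvert g) + p v)%N.
Proof. by rewrite /hits nedges_add_vertex -cats1 !count_cat /= !addn0 addnACA !addnA. Qed.

Lemma hits_add_edge p (g : mgraph) (u v : 'I_(nvert g)) :
  hits p (add_edge u v) = (hits p g + p u + p v)%N.
Proof. by rewrite /hits nedges_add_edge -cats1 !count_cat /= !addn0 addnACA !addnA. Qed.

Lemma sum_count_eq (n : nat) (T : Type) (s : seq T) (a : T -> 'I_n) (p : pred nat) :
  (\sum_(v < n) p v * count (fun e => a e == v) s)%N = count (fun e => p (a e)) s.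
Proof.
elim: s => [|e s IH] /=; first by rewrite big1 // => v _; rewrite muln0.
under eq_bigr do rewrite mulnDr.
rewrite big_split /= IH; congr (_ + _)%N.
rewrite (bigD1 (a e)) //= eqxx muln1 big1 ?addn0 // => v.
by rewrite eq_sym => /negbTE ->; rewrite muln0.
Qed.

Lemma sum_deg (p : pred nat) (g : mgraph) :
  (\sum_(v < nvert g) p v * deg v)%N = hits p g.
Proof.
rewrite /hits /nedges !count_map -!sum_count_eq -big_split /=.
by apply: eq_bigr => v _; rewrite -mulnDr.
Qed.

Lemma hits_predT (g : mgraph) : hits predT g = (2 * size (edges g))%N.
Proof. by rewrite /hits /nedges !count_predT size_map mul2n addnn. Qed.

Lemma leq_hits (p : pred nat) (g : mgraph) : (hits p g <= 2 * size (edges g))%N.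
Proof.
rewrite /hits mul2n -addnn -(size_map (fun e => (val e.1, val e.2)) (edges g)).
by rewrite leq_add // count_size.
Qed.

Lemma size_edges_add_vertex (g : mgraph) (v : 'I_(nvert g)) :
  size (edges (add_vertex v)) = (size (edges g)).+1.
Proof. by rewrite /add_vertex /= size_rcons size_map. Qed.

Lemma size_edges_add_edge (g : mgraph) (u v : 'I_(nvert g)) :
  size (edges (add_edge u v)) = (size (edges g)).+1.
Proof. by rewrite /add_edge /= size_rcons. Qed.

Lemma nvert_add_vertex (g : mgraph) (v : 'I_(nvert g)) :
  nvert (add_vertex v) = (nvert g).+1.
Proof. by []. Qed.

Lemma nvert_add_edge (g : mgraph) (u v : 'I_(nvert g)) :
  nvert (add_edge u v) = nvert g.
Proof. by []. Qed.

(** Invariants of the graphs that can occur at time [t], namely those used by the one-step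
    estimates. Positive degrees allow the division by the degree in [avg_phi]. *)
Record reachable (t : nat) (g : mgraph) : Prop := {
  reachable_size : size (edges g) = t.+1;
  reachable_nvert : (nvert g <= t.+1)%N;
  reachable_deg : forall i, (i < nvert g)%N -> (0 < degn g i)%N }.

Lemma reachable_loop : reachable 0 loop_graph.
Proof. by split=> // i; rewrite ltnS leqn0 => /eqP ->. Qed.

Lemma reachable_add_vertex t (g : mgraph) (v : 'I_(nvert g)) :
  reachable t g -> reachable t.+1 (add_vertex v).
Proof.
case=> sg ng dg; split.
- by rewrite size_edges_add_vertex sg.
- by rewrite nvert_add_vertex.
- move=> i; rewrite nvert_add_vertex ltnS leq_eqVlt /degn hits_add_vertex /=.
  case/orP => [/eqP ->|/dg h]; first by rewrite eqxx addn1 addSn.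
  by rewrite -addnA ltn_addr.
Qed.

Lemma reachable_add_edge t (g : mgraph) (u v : 'I_(nvert g)) :
  reachable t g -> reachable t.+1 (add_edge u v).
Proof.
case=> sg ng dg; split.
- by rewrite size_edges_add_edge sg.
- by rewrite nvert_add_edge; lia.
- by move=> i /dg; rewrite /degn hits_add_edge -addnA => /ltn_addr.
Qed.

(** A consequence of inclusion of multigraphs, preserved by both kinds of steps; it keeps track of
    the graph on which an expectation is conditioned. *)
Definition extends (g0 g : mgraph) : Prop :=
  (nvert g0 <= nvert g)%N /\ forall i, (degn g0 i <= degn g i)%N.

Lemma extends_refl g : extends g g. Proof. by []. Qed.

Lemma extends_add_vertex g0 (g : mgraph) (v : 'I_(nvert g)) :
  extends g0 g -> extends g0 (add_vertex v).
Proof.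
case=> ng dg; split; first exact: leqW.
by move=> i; apply: (leq_trans (dg i)); rewrite /degn hits_add_vertex -addnA leq_addr.
Qed.

Lemma extends_add_edge g0 (g : mgraph) (u v : 'I_(nvert g)) :
  extends g0 g -> extends g0 (add_edge u v).
Proof.
case=> ng dg; split=> // i.
by apply: (leq_trans (dg i)); rewrite /degn hits_add_edge -addnA leq_addr.
Qed.

(** * Conditional expectation over one step *)

Section Averages.
Context {R : realType}.
Implicit Types (g : mgraph) (psi chi : mgraph -> R) (h : nat -> R) (x : R).

Definition mean g h : R := \sum_(v < nvert g) pi_deg R v * h v.

(** The conditional expectation of [psi] at the next graph, given that the current one is [g] and
    that a vertex-step has probability [x]. *)
Definition avg x psi g : R :=
  x * (\sum_(v < nvert g) pi_deg R v * psi (add_vertex v)) +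
  (1 - x) * (\sum_(u < nvert g) \sum_(v < nvert g)
                pi_deg R u * pi_deg R v * psi (add_edge u v)).

(** The measure of [p] under the degree distribution, see [mean_pred]; the total degree is written
    as twice the number of edges. *)
Definition dens g (p : pred nat) : R := (hits p g)%:R / (2 * size (edges g))%N%:R.

Lemma pi_deg_ge0 g (v : 'I_(nvert g)) : 0 <= pi_deg R v.
Proof. by rewrite /pi_deg divr_ge0. Qed.

Lemma dens_ge0 g p : 0 <= dens g p.
Proof. by rewrite /dens divr_ge0. Qed.

Lemma dens_le1 g p : dens g p <= 1.
Proof.
rewrite /dens; case: (posnP (2 * size (edges g))) => [->|h].
  by rewrite invr0 mulr0 ler01.
by rewrite ler_pdivrMr ?ltr0n // mul1r ler_nat leq_hits.
Qed.

Lemma sum_deg_predT g : (\sum_(v < nvert g) deg v)%N = (2 * size (edges g))%N.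
Proof.
by rewrite -hits_predT -sum_deg; apply: eq_bigr => v _; rewrite mul1n.
Qed.

Lemma mean_pred g (p : pred nat) : mean g (fun i => (p i)%:R) = dens g p.
Proof.
rewrite /mean /dens -sum_deg natr_sum mulr_suml.
apply: eq_bigr => v _; rewrite /pi_deg sum_deg_predT natrM; ring.
Qed.

Lemma mean_cst t g c : reachable t g -> mean g (fun=> c) = c.
Proof.
move=> rg; rewrite /mean -mulr_suml.
have := mean_pred g predT; rewrite /mean /dens hits_predT divff; last first.
  by rewrite pnatr_eq0 (reachable_size rg).
by under eq_bigr do rewrite mulr1; move=> ->; rewrite mul1r.
Qed.

Lemma meanD g h1 h2 : mean g (fun i => h1 i + h2 i) = mean g h1 + mean g h2.
Proof. by rewrite /mean -big_split /=; apply: eq_bigr => v _; rewrite mulrDr. Qed.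

Lemma meanZ g c h : mean g (fun i => c * h i) = c * mean g h.
Proof. by rewrite /mean mulr_sumr; apply: eq_bigr => v _; rewrite mulrCA. Qed.

Lemma eq_mean g h1 h2 : h1 =1 h2 -> mean g h1 = mean g h2.
Proof. by move=> h; apply: eq_bigr => v _; rewrite h. Qed.

(** Once [psi] after a step is a function of the chosen labels only, the expectation is an iterated
    mean, computable by [mean_affine]. *)
Lemma avgE x psi g (a : nat -> R) (b : nat -> nat -> R) :
  (forall v : 'I_(nvert g), psi (add_vertex v) = a v) ->
  (forall u v : 'I_(nvert g), psi (add_edge u v) = b u v) ->
  avg x psi g = x * mean g a + (1 - x) * mean g (fun u => mean g (b u)).
Proof.
move=> ha hb; rewrite /avg /mean; congr (_ * _ + _ * _).
  by apply: eq_bigr => v _; rewrite ha.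
apply: eq_bigr => u _; rewrite mulr_sumr.
by apply: eq_bigr => v _; rewrite hb mulrA.
Qed.

Lemma ler_avg x psi chi g : 0 <= x <= 1 ->
  (forall v : 'I_(nvert g), psi (add_vertex v) <= chi (add_vertex v)) ->
  (forall u v : 'I_(nvert g), psi (add_edge u v) <= chi (add_edge u v)) ->
  avg x psi g <= avg x chi g.
Proof.
case/andP=> x0 x1 ha hb; apply: lerD.
  by rewrite ler_wpM2l //; apply: ler_sum => v _; rewrite ler_wpM2l ?pi_deg_ge0.
rewrite ler_wpM2l ?subr_ge0 //; apply: ler_sum => u _; apply: ler_sum => v _.
by rewrite ler_wpM2l ?mulr_ge0 ?pi_deg_ge0.
Qed.

Lemma avgD x psi chi g :
  avg x (fun g' => psi g' + chi g') g = avg x psi g + avg x chi g.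
Proof.
rewrite /avg [RHS]addrACA -!mulrDr -!big_split /=; congr (_ * _ + _ * _).
  by apply: eq_bigr => v _; rewrite mulrDr.
by apply: eq_bigr => u _; rewrite -big_split; apply: eq_bigr => v _; rewrite mulrDr.
Qed.

Lemma avgZ x c psi g : avg x (fun g' => c * psi g') g = c * avg x psi g.
Proof.
rewrite /avg mulrDr !(mulrCA c).
congr (_ * _ + _ * _); rewrite mulr_sumr.
  by apply: eq_bigr => v _; rewrite mulrCA.
by apply: eq_bigr => u _; rewrite mulr_sumr; apply: eq_bigr => v _; rewrite mulrCA.
Qed.

End Averages.

(** * The Markov operator of the process *)

Section Iterates.
Context {R : realType} (f : R -> R).
Hypothesis f01 : forall t : nat, (0 < t)%N -> 0 <= f t%:R <= 1.
Implicit Types (g : mgraph) (psi chi : mgraph -> R).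

(* expect s n psi g is the conditional expectation of psi (G_(s+n)) given
   G_s = g. *)
Fixpoint expect (s n : nat) psi g : R :=
  if n is n'.+1 then avg (f s.+1%:R) (expect s.+1 n' psi) g else psi g.

Lemma expect_add s a b psi g :
  expect s (a + b) psi g = expect s a (expect (s + a) b psi) g.
Proof.
elim: a s g => [|a IH] s g /=; first by rewrite addn0.
congr (avg _ _ g); apply/funext => g'.
by rewrite IH addSnnS.
Qed.

Lemma expectSr s n psi g :
  expect s n.+1 psi g = expect s n (fun g' => avg (f (s + n).+1%:R) psi g') g.
Proof. by rewrite -addn1 expect_add. Qed.

(** The comparison is required only on graphs that satisfy the invariants and extend [g0], since the
    one-step estimates are proved for these. *)
Lemma ler_expect s n psi chi g0 g : reachable s g -> extends g0 g ->
  (forall g', reachable (s + n) g' -> extends g0 g' -> psi g' <= chi g') ->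
  expect s n psi g <= expect s n chi g.
Proof.
elim: n s g => [|n IH] s g rg eg h /=.
  by apply: h => //; rewrite addn0.
apply: ler_avg => [|v|u v]; first exact: f01.
- apply: IH; [exact: reachable_add_vertex|exact: extends_add_vertex|].
  by move=> g'; rewrite addSnnS; exact: h.
- apply: IH; [exact: reachable_add_edge|exact: extends_add_edge|].
  by move=> g'; rewrite addSnnS; exact: h.
Qed.

(** The mean of a supermartingale does not increase. The function depends on time so that it can
    carry a deterministic weight. *)
Lemma expect_super s n (psi : nat -> mgraph -> R) g0 g :
  (forall u g', (u < n)%N -> reachable (s + u) g' -> extends g0 g' ->
     avg (f (s + u).+1%:R) (psi u.+1) g' <= psi u g') ->
  reachable s g -> extends g0 g ->
  expect s n (psi n) g <= psi 0%N g.
Proof.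
move=> h rg eg; elim: n h => [|n IH] h //.
rewrite expectSr; apply: le_trans (IH _); last by move=> u g' /ltnW; exact: h.
by apply: (ler_expect rg eg) => g' rg' eg'; exact: h.
Qed.

Lemma expectD s n psi chi g :
  expect s n (fun g' => psi g' + chi g') g = expect s n psi g + expect s n chi g.
Proof.
elim: n s g => [|n IH] s g //=; rewrite -avgD; congr (avg _ _ g).
by apply/funext => g'; exact: IH.
Qed.

Lemma expectZ s n c psi g :
  expect s n (fun g' => c * psi g') g = c * expect s n psi g.
Proof.
elim: n s g => [|n IH] s g //=; rewrite -avgZ; congr (avg _ _ g).
by apply/funext => g'; exact: IH.
Qed.

Lemma expect_cst s n c g : reachable s g -> expect s n (fun=> c) g = c.
Proof.
elim: n s g => [|n IH] s g rg //=.
rewrite (@avgE _ _ _ _ (fun=> c) (fun _ _ => c)).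
- by rewrite !(mean_cst _ rg); ring.
- by move=> v; apply: IH; exact: reachable_add_vertex.
- by move=> u v; apply: IH; exact: reachable_add_edge.
Qed.

Lemma expect_ge0 s n psi g : (forall g', 0 <= psi g') -> 0 <= expect s n psi g.
Proof.
move=> psi0; elim: n s g => [|n IH] s g //=.
have /andP[f0 f1] := f01 (ltn0Sn s); rewrite /avg.
by rewrite addr_ge0 // mulr_ge0 ?subr_ge0 //; apply: sumr_ge0 => u _;
  rewrite ?sumr_ge0 // => *; rewrite ?mulr_ge0 ?pi_deg_ge0.
Qed.

End Iterates.

(** * Few edges between late vertices *)

Definition inner (p : pred nat) (g : mgraph) : nat :=
  count (fun e => p e.1 && p e.2) (nedges g).

Lemma inner_add_vertex p (g : mgraph) (v : 'I_(nvert g)) :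
  inner p (add_vertex v) = (inner p g + (p (nvert g) && p v))%N.
Proof. by rewrite /inner nedges_add_vertex -cats1 count_cat /= addn0. Qed.

Lemma inner_add_edge p (g : mgraph) (u v : 'I_(nvert g)) :
  inner p (add_edge u v) = (inner p g + (p u && p v))%N.
Proof. by rewrite /inner nedges_add_edge -cats1 count_cat /= addn0. Qed.

(* Distinct ordered pairs in A are edges up to orientation, hence the factor 2. *)
Lemma clique_inner (g : mgraph) (A : {set 'I_(nvert g)}) (p : pred nat) :
  is_clique A -> (forall v, v \in A -> p v) ->
  (#|A| * #|A|.-1 <= 2 * inner p g)%N.
Proof.
move=> cA pA.
pose E := [set e in [seq e <- edges g | p (val e.1) && p (val e.2)]].
pose E' := [set (e.2, e.1) | e in E].
have cE : (#|E| <= inner p g)%N.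
  rewrite cardsE; apply: leq_trans (card_size _) _.
  by rewrite size_filter /inner /nedges count_map.
have cE' : (#|E'| <= inner p g)%N by apply: leq_trans (leq_imset_card _ _) cE.
pose D := [set x in finset.setX A A | x.1 != x.2].
have DE : D \subset E :|: E'.
  apply/fintype.subsetP => -[u v]; rewrite !inE /= => /andP[/andP[uA vA] uv].
  have /orP[h|h] : Defs.adjacent u v.
    by move/forall_inP: cA => /(_ u uA) /forall_inP /(_ v vA) /implyP; apply.
  - by rewrite mem_filter /= h !pA.
  - apply/orP; right; apply/imsetP; exists (v, u) => //.
    by rewrite inE mem_filter /= h !pA.
have cD : (#|A| * #|A|.-1 = #|D|)%N.
  have -> : D = finset.setX A A :\: [set (u, u) | u in A].
    apply/finset.setP => -[u v]; rewrite !inE /=.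
    case: (boolP ((u \in A) && (v \in A))) => [/andP[uA vA]|]; last by rewrite !andbF.
    rewrite !andbT; case: eqP => [<-|uv]; first by rewrite imset_f.
    by symmetry; apply/negP => /imsetP[w _ [eu ev]]; apply: uv; rewrite eu ev.
  rewrite cardsDS; last first.
    by apply/fintype.subsetP => _ /imsetP[u uA ->]; rewrite !inE uA.
  by rewrite cardsX card_in_imset => [|u v _ _ [->]//]; case: #|A| => // n; nia.
rewrite cD; apply: leq_trans (subset_leq_card DE) _.
by apply: leq_trans (leq_card_setU _ _) _; rewrite mul2n -addnn leq_add.
Qed.

(** Labels are ranks of birth: a maximum clique has at most [k] members among the first [k]
    vertices, and its other members form a clique to which [clique_inner] applies. *)
Lemma clique_number_split (g : mgraph) (k : nat) :
  exists2 a, (clique_number g <= k + a)%N &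
             (a * a.-1 <= 2 * inner (fun i => (k <= i)%N) g)%N.
Proof.
have [A cA ->] : exists2 A : {set 'I_(nvert g)}, is_clique A & clique_number g = #|A|.
  rewrite /clique_number; have [|A cA ->] := @eq_bigmax_cond _ (@is_clique g) (fun A => #|A|).
    apply/card_gt0P; exists finset.set0; apply/forall_inP => u.
    by rewrite finset.in_set0.
  by exists A.
pose B := [set v in A | (k <= v)%N].
exists #|B|.
  have -> : A = [set v in A | (v < k)%N] :|: B.
    by apply/finset.setP => v; rewrite !inE -andb_orr ltnNge orNb andbT.
  apply: leq_trans (leq_card_setU _ _) _; rewrite leq_add2r.
  (* The injection into the first [k] labels uses [inord], which needs a nonempty ordinal type;
     hence [k = 0] is separate. *)
  rewrite -[leqRHS]card_ord; case: k {B} => [|k].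
    by rewrite card_ord leqn0 cards_eq0; apply/eqP/finset.setP => v; rewrite !inE andbF.
  rewrite -(@card_in_imset _ _ (fun v : 'I_(nvert g) => inord v : 'I_k.+1)) ?max_card //.
  move=> u v; rewrite !inE => /andP[_ uk] /andP[_ vk] /(congr1 val) /=.
  by rewrite !inordK // => /val_inj.
apply: clique_inner => [|v]; last by rewrite inE => /andP[].
apply/forall_inP => u; rewrite inE => /andP[uA _]; apply/forall_inP => v.
rewrite inE => /andP[vA _].
by move/forall_inP: cA => /(_ u uA) /forall_inP /(_ v vA).
Qed.

(** * One-step moments of the total degree of a set of vertices and of its inner edges *)

Section Moments.
Context {R : realType}.

Lemma mean_affine (g : mgraph) t (a b : R) (p : pred nat) : reachable t g ->
  mean g (fun i => a + b * (p i)%:R) = a + b * dens g p.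
Proof. by move=> rg; rewrite meanD (mean_cst _ rg) meanZ mean_pred. Qed.

Lemma densE t (g : mgraph) p : reachable t g ->
  dens g p = (hits p g)%:R / (2 * (t%:R + 1)) :> R.
Proof.
by move=> rg; rewrite /dens (reachable_size rg) natrM -[t.+1%:R]natr1.
Qed.

(** The newborn vertex lies in [p], so a vertex-step adds one certain end and one random end, an
    edge-step two random ends. *)
Lemma avg_hits t (g : mgraph) (p : pred nat) (x : R) : reachable t g -> p (nvert g) ->
  avg x (fun g' => (hits p g')%:R) g =
  (hits p g)%:R + x * (1 + dens g p) + (1 - x) * (2 * dens g p).
Proof.
move=> rg pn; set S := (hits p g)%:R : R.
rewrite (@avgE _ _ _ _ (fun i => S + 1 + 1 * (p i)%:R)
  (fun i j => S + (p i)%:R + 1 * (p j)%:R)); last 2 first.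
- by move=> v; rewrite hits_add_vertex 2!natrD pn mul1r.
- by move=> u v; rewrite hits_add_edge 2!natrD mul1r.
rewrite (mean_affine _ _ _ rg).
under [X in mean g X]eq_fun do rewrite (mean_affine _ _ _ rg).
under [X in mean g X]eq_fun => i do rewrite addrAC -[(p i)%:R]mul1r.
by rewrite (mean_affine _ _ _ rg); ring.
Qed.

(** Indicators equal their squares, so the square after a step is affine in each indicator
    separately and [mean_affine] applies. *)
Lemma avg_hits_sqr t (g : mgraph) (p : pred nat) (x : R) : reachable t g -> p (nvert g) ->
  avg x (fun g' => (hits p g')%:R ^+ 2) g =
  x * (((hits p g)%:R + 1) ^+ 2 + (2 * (hits p g)%:R + 3) * dens g p) +
  (1 - x) * ((hits p g)%:R ^+ 2 + 4 * (hits p g)%:R * dens g p + 2 * dens g p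
             + 2 * dens g p ^+ 2).
Proof.
move=> rg pn; set S := (hits p g)%:R : R.
rewrite (@avgE _ _ _ _ (fun i => (S + 1) ^+ 2 + (2 * S + 3) * (p i)%:R)
  (fun i j => (S ^+ 2 + (2 * S + 1) * (p i)%:R) + (2 * S + 1 + 2 * (p i)%:R) * (p j)%:R));
  last 2 first.
- move=> v; rewrite hits_add_vertex 2!natrD pn -/S.
  by case: (p v) => /=; ring.
- move=> u v; rewrite hits_add_edge 2!natrD -/S.
  by case: (p u); case: (p v) => /=; ring.
rewrite (mean_affine _ _ _ rg).
under [X in mean g X]eq_fun do rewrite (mean_affine _ _ _ rg).
rewrite (@eq_mean _ _ _ (fun i => (S ^+ 2 + (2 * S + 1) * dens g p) +
  (2 * S + 1 + 2 * dens g p) * (p i)%:R)); last by move=> i; ring.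
by rewrite (mean_affine _ _ _ rg); ring.
Qed.

Lemma avg_inner t (g : mgraph) (p : pred nat) (x : R) : reachable t g -> p (nvert g) ->
  avg x (fun g' => (inner p g')%:R) g =
  (inner p g)%:R + x * dens g p + (1 - x) * dens g p ^+ 2.
Proof.
move=> rg pn; set S := (inner p g)%:R : R.
rewrite (@avgE _ _ _ _ (fun i => S + 1 * (p i)%:R)
  (fun i j => S + (p i)%:R * (p j)%:R)); last 2 first.
- by move=> v; rewrite inner_add_vertex natrD pn mul1r.
- by move=> u v; rewrite inner_add_edge natrD; case: (p u); case: (p v) => /=; ring.
rewrite (mean_affine _ _ _ rg).
under [X in mean g X]eq_fun do rewrite (mean_affine _ _ _ rg).
rewrite (@eq_mean _ _ _ (fun i => S + dens g p * (p i)%:R)); last by move=> i; ring.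
by rewrite (mean_affine _ _ _ rg); ring.
Qed.

End Moments.

(** * Total degree of the late vertices and edges between them *)

Section LateVertices.
Context {R : realType} (f : R -> R).
Hypothesis f01 : forall t : nat, (0 < t)%N -> 0 <= f t%:R <= 1.
Variables (m : nat) (g0 : mgraph).
Hypothesis rg0 : reachable m g0.

Let late : pred nat := fun i => (nvert g0 <= i)%N.
Let S g : R := (hits late g)%:R.
Let X g : R := (inner late g)%:R.
Let theta n : R := \sum_(u < n) f (m + u).+1%:R / (m + u).+2%:R.

Lemma hits_late0 : S g0 = 0.
Proof.
rewrite /S /hits /nedges !count_map (eq_count (a2 := pred0)) => [|e /=].
  rewrite count_pred0 (eq_count (a2 := pred0)) ?count_pred0 // => e /=.
  by rewrite /late leqNgt ltn_ord.
by rewrite /late leqNgt ltn_ord.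
Qed.

Lemma inner_late0 : X g0 = 0.
Proof.
rewrite /X /inner /nedges count_map (eq_count (a2 := pred0)) ?count_pred0 // => e /=.
by rewrite /late leqNgt ltn_ord.
Qed.

Let theta_ge0 n : 0 <= theta n.
Proof.
apply: sumr_ge0 => u _; rewrite divr_ge0 //.
by have /andP[] := f01 (ltn0Sn (m + u)).
Qed.

Let thetaS n : theta n.+1 = theta n + f (m + n).+1%:R / (m + n).+2%:R.
Proof. by rewrite /theta big_ord_recr. Qed.

(** With [y = m + n + 1] edges, a step adds to [S] at most [x + S / y] in mean, so [S] divided by
    the number of edges gains at most [x / (y + 1)], the increment of [theta]. *)
Lemma expect_hits_late n : expect f m n S g0 <= (m + n).+1%:R * theta n.
Proof.
elim: n => [|n IH]; first by rewrite /= hits_late0 mulr_ge0.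
rewrite expectSr.
set x := f (m + n).+1%:R; have /andP[x0 x1] : 0 <= x <= 1 := f01 (ltn0Sn _).
pose c : R := (m + n).+2%:R / (m + n).+1%:R.
apply: (@le_trans _ _ (expect f m n (fun g => c * S g + x) g0)).
  apply: (ler_expect f01 rg0 (extends_refl g0)) => g rg [ng _].
  rewrite (avg_hits _ rg) // -/(S g) -/x.
  have -> : c * S g = S g + 2 * dens g late.
    rewrite (densE _ rg) -/(S g) /c -[(m + n).+2%:R]natr1 -[(m + n).+1%:R]natr1.
    by field; have := ler0n R (m + n); lra.
  have := @dens_ge0 R g late; nra.
rewrite expectD expectZ (expect_cst f _ _ rg0) addnS.
apply: (@le_trans _ _ (c * ((m + n).+1%:R * theta n) + x)).
  by rewrite lerD2r ler_wpM2l // divr_ge0.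
rewrite thetaS mulrDr /c -/x le_eqVlt; apply/orP; left; apply/eqP.
have y0 : 0 < (m + n).+1%:R :> R by rewrite ltr0n.
rewrite -[(m + n).+2%:R]natr1; set y := (m + n).+1%:R in y0 *.
by field; lra.
Qed.

(** The second lower bound on [Theta] gives [y * Theta >= 1] for every later edge count [y]; errors
    of order [x] are then absorbed by [x * y * Theta]. *)
Variables (N : nat) (Theta : R).
Hypothesis thetaN : theta N <= Theta.
Hypothesis Theta_lb : (m.+1)%:R^-1 <= Theta.

Let theta_le n : (n <= N)%N -> theta n <= Theta.
Proof.
move=> nN; apply: le_trans thetaN; rewrite -(subnK nN) addnC.
elim: (N - n)%N => [|j IH]; first by rewrite addn0.
rewrite addnS thetaS; apply: le_trans IH _; rewrite lerDl divr_ge0 //.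
by have /andP[] := f01 (ltn0Sn (m + (n + j))).
Qed.

(** The second moment is multiplied by [(y + 2) / y] at each step, which the factor [y * (y + 1)]
    cancels. The increment of [theta] pays for the terms of order [x * y * Theta], the telescoping
    difference of inverses for the remaining [2 * Theta]. *)
Lemma expect_hits_sqr_late n : (n <= N)%N ->
  expect f m n (fun g => S g ^+ 2) g0 <=
  (m + n).+1%:R * (m + n).+2%:R *
    (4 * Theta * theta n + 2 * Theta * ((m.+1)%:R^-1 - (m + n).+1%:R^-1)).
Proof.
elim: n => [|n IH] nN.
  by rewrite /= hits_late0 expr0n /= addn0 subrr /theta big_ord0 !(mulr0, addr0).
have {}IH := IH (ltnW nN).
rewrite expectSr.
set x := f (m + n).+1%:R; have /andP[x0 x1] : 0 <= x <= 1 := f01 (ltn0Sn _).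
set y : R := (m + n).+1%:R in IH *.
have y0 : 0 < y by rewrite ltr0n.
have yE : (m + n).+2%:R = y + 1 by rewrite -natr1.
pose c : R := (y + 2) / y.
apply: (@le_trans _ _ (expect f m n (fun g => c * S g ^+ 2 +
    ((2 * x + 2 / y) * S g + 2 * x)) g0)).
  apply: (ler_expect f01 rg0 (extends_refl g0)) => g rg [ng _].
  rewrite (avg_hits_sqr _ rg) // -/(S g) -/x.
  have := @dens_ge0 R g late; have := @dens_le1 R g late.
  have -> : dens g late = S g / (2 * y).
    by rewrite (densE _ rg) -/(S g) /y -[(m + n).+1%:R]natr1.
  have S0 : 0 <= S g by rewrite ler0n.
  set r := S g / (2 * y) => r1 r0.
  have -> : c * S g ^+ 2 = S g ^+ 2 + 4 * S g * r.
    by rewrite /c /r; field; lra.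
  have -> : (2 * x + 2 / y) * S g = 2 * x * S g + 4 * r by rewrite /r; field; lra.
  (* The bound exceeds the exact conditional mean by precisely the sum of the quantities in [h1] and
     [h2]. *)
  have h1 : 0 <= x * (2 * (S g * r) + r + 1).
    by have Sr := mulr_ge0 S0 r0; apply: mulr_ge0 => //; lra.
  have h2 : 0 <= (1 - x) * (2 * (r * (1 - r))).
    have rr : 0 <= r * (1 - r) by apply: mulr_ge0 => //; lra.
    by apply: mulr_ge0; lra.
  lra.
rewrite expectD expectZ expectD expectZ (expect_cst f _ _ rg0) addnS.
rewrite -[(m + n).+3%:R]natr1 yE.
have he := expect_hits_late n; rewrite -/y in he.
have hT := theta_le (ltnW nN); have h0 := theta_ge0 n.
rewrite thetaS -/x yE; set th := theta n in he hT h0 IH *.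
rewrite yE in IH.
have m0 : 0 < (m.+1)%:R^-1 :> R by rewrite invr_gt0 ltr0n.
have ym : y^-1 <= (m.+1)%:R^-1.
  by rewrite lef_pV2 ?posrE ?ltr0n // ler_nat ltnS leq_addr.
have Tlb := Theta_lb; set w : R := (m.+1)%:R^-1 in m0 ym Tlb IH *.
set e := expect _ _ _ _ _ in he *; set q := expect _ _ _ _ _ in IH *.
have y20 : 0 < y + 2 by lra.
have B1 : c * q <= (y + 1) * (y + 2) * (4 * Theta * th + 2 * Theta * (w - y^-1)).
  apply: le_trans (ler_wpM2l _ IH) _; first by rewrite divr_ge0 // ltW.
  by rewrite le_eqVlt; apply/orP; left; apply/eqP; rewrite /c; field; lra.
have B2 : (2 * x + 2 / y) * e <= 2 * x * y * Theta + 2 * Theta.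
  have yi : 0 < y^-1 by rewrite invr_gt0.
  apply: (@le_trans _ _ ((2 * x + 2 / y) * (y * Theta))).
    apply: ler_wpM2l; first by rewrite addr_ge0 ?mulr_ge0 // ltW.
    by apply: (le_trans he); apply: ler_wpM2l => //; exact: ltW.
  by rewrite le_eqVlt; apply/orP; left; apply/eqP; field; lra.
have yT : 1 <= y * Theta.
  rewrite -(@divff _ y) ?ler_wpM2l ?(ltW y0) ?gt_eqF //.
  exact: le_trans ym Tlb.
have -> : (y + 1) * (y + 1 + 1) *
    (4 * Theta * (th + x / (y + 1)) + 2 * Theta * (w - (y + 1)^-1)) =
  (y + 1) * (y + 2) * (4 * Theta * th + 2 * Theta * (w - y^-1)) +
  4 * Theta * x * (y + 2) + 2 * Theta * ((y + 2) / y).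
  by field; lra.
have h2 : 1 <= (y + 2) / y by rewrite ler_pdivlMr //; lra.
have T0 : 0 <= Theta by exact: le_trans (ltW m0) Tlb.
have h3 := ler_wpM2l x0 yT.
have h4 := ler_wpM2l T0 h2.
have h5 := mulr_ge0 T0 x0.
have h6 := mulr_ge0 h5 (ltW y0).
move: B1 B2 h3 h4 h5 h6; rewrite !mulrA.
set a1 := _ * q; set a2 := _ * e; clearbody a1 a2 th x w.
have -> : Theta * (y + 2) / y = Theta + Theta * 2 / y by field; lra.
have -> : 2 * Theta * (y + 2) / y = 2 * Theta + 2 * (Theta * 2 / y) by field; lra.
set z := Theta * 2 / y; set B := (y + 1) * _ * _; clearbody z B c y; move=> H1 H2 H3 H4 H5 H6; lra.
Qed.

Lemma expect_hits_sqr_le n : (n <= N)%N ->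
  expect f m n (fun g => S g ^+ 2) g0 <=
  (m + n).+1%:R * (m + n).+2%:R * (6 * Theta ^+ 2).
Proof.
move=> nN; apply: le_trans (expect_hits_sqr_late nN) _.
rewrite ler_wpM2l ?mulr_ge0 //.
have := theta_le nN; have := theta_ge0 n.
have : 0 < (m + n).+1%:R^-1 :> R by rewrite invr_gt0 ltr0n.
have : 0 < (m.+1)%:R^-1 :> R by rewrite invr_gt0 ltr0n.
move: Theta_lb; set w := (m.+1)%:R^-1; set y := (m + n).+1%:R^-1.
set th := theta n; clearbody w y th => Tw w0 y0 th0 thT.
have T0 : 0 <= Theta by lra.
have : Theta * th <= Theta * Theta by rewrite ler_wpM2l.
have : Theta * (w - y) <= Theta * Theta by rewrite ler_wpM2l //; lra.
by rewrite expr2; lra.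
Qed.

(* Two ends chosen at random at time u are both late with probability about
   (S / (2 u)) ^ 2, whose mean is O(Theta ^ 2) by the second moment bound. *)
Lemma expect_inner_late n : (n <= N)%N ->
  expect f m n X g0 <= (m + n).+1%:R * Theta * theta n + n%:R * (3 * Theta ^+ 2).
Proof.
elim: n => [|n IH] nN.
  by rewrite /= inner_late0 /theta big_ord0 mulr0 mul0r addr0.
have {}IH := IH (ltnW nN).
rewrite expectSr.
set x := f (m + n).+1%:R; have /andP[x0 x1] : 0 <= x <= 1 := f01 (ltn0Sn _).
set y : R := (m + n).+1%:R in IH *.
have y0 : 0 < y by rewrite ltr0n.
have y1 : 1 <= y by rewrite ler1n.
have yE : (m + n).+2%:R = y + 1 by rewrite -natr1.
have yi : 0 < y^-1 by rewrite invr_gt0.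
apply: (@le_trans _ _ (expect f m n (fun g => X g +
    (x / (2 * y) * S g + (4 * y ^+ 2)^-1 * S g ^+ 2)) g0)).
  apply: (ler_expect f01 rg0 (extends_refl g0)) => g rg [ng _].
  rewrite (avg_inner _ rg) // -/(X g) -/x.
  have -> : dens g late = S g / (2 * y).
    by rewrite (densE _ rg) -/(S g) /y -[(m + n).+1%:R]natr1.
  have -> : x / (2 * y) * S g = x * (S g / (2 * y)) by field; lra.
  have -> : (4 * y ^+ 2)^-1 * S g ^+ 2 = (S g / (2 * y)) ^+ 2 by field; lra.
  have := mulr_ge0 x0 (sqr_ge0 (S g / (2 * y))).
  by set r := S g / (2 * y); clearbody r x => h; lra.
rewrite expectD expectD !expectZ addnS yE.
have he := expect_hits_late n; rewrite -/y in he.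
have hq := expect_hits_sqr_le (ltnW nN); rewrite -/y yE in hq.
have hT := theta_le (ltnW nN); have h0 := theta_ge0 n.
rewrite thetaS -/x yE -[n.+1%:R]natr1; set th := theta n in he hT h0 IH *.
have B1 : x / (2 * y) * expect f m n S g0 <= x * Theta.
  apply: (@le_trans _ _ (x / (2 * y) * (y * Theta))).
    rewrite ler_wpM2l ?(le_trans he) ?ler_wpM2l ?(ltW y0) //.
    by rewrite divr_ge0 // mulr_ge0 // ltW.
  have -> : x / (2 * y) * (y * Theta) = x * Theta / 2 by field; lra.
  nra.
have B2 : (4 * y ^+ 2)^-1 * expect f m n (fun g => S g ^+ 2) g0 <= 3 * Theta ^+ 2.
  apply: (@le_trans _ _ ((4 * y ^+ 2)^-1 * (y * (y + 1) * (6 * Theta ^+ 2)))).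
    by rewrite ler_wpM2l // invr_ge0 mulr_ge0 // sqr_ge0.
  have -> : (4 * y ^+ 2)^-1 * (y * (y + 1) * (6 * Theta ^+ 2)) =
     (3 / 2 * Theta ^+ 2) * (1 + y^-1) by field; lra.
  have : y^-1 <= 1 by rewrite invf_le1.
  move=> /(ler_wpM2l (sqr_ge0 Theta)).
  by set a := Theta ^+ 2; set b := y^-1; clearbody a b => h; lra.
have -> : (y + 1) * Theta * (th + x / (y + 1)) = (y + 1) * Theta * th + Theta * x.
  by field; lra.
have Tth : 0 <= Theta * th by rewrite mulr_ge0 // (le_trans h0 hT).
move: B1 B2 IH Tth; set a1 := _ * expect _ _ _ _ _; set a2 := _ * expect _ _ _ _ _.
set a3 := expect _ _ _ _ _; set i := n%:R; clearbody a1 a2 a3 th x y i => *; lra.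
Qed.

Lemma expect_inner_le : expect f m N X g0 <= 4 * (m + N).+1%:R * Theta ^+ 2.
Proof.
apply: le_trans (expect_inner_late (leqnn N)) _.
have h1 : N%:R <= (m + N).+1%:R :> R by rewrite ler_nat; lia.
have hT := theta_le (leqnn N); have h0 := theta_ge0 N.
have T0 := le_trans h0 hT.
have h2 : (m + N).+1%:R * Theta * theta N <= (m + N).+1%:R * Theta * Theta.
  by rewrite ler_wpM2l // mulr_ge0.
have h3 := ler_wpM2r (sqr_ge0 Theta) h1.
move: h2 h3; rewrite expr2; set i := N%:R; set y := (m + N).+1%:R.
by set th := theta N; clearbody i y th => *; lra.
Qed.

End LateVertices.

(** * Number of vertices, and the upper bound for the clique number *)

Section VertexCount.
Context {R : realType} (f : R -> R).
Hypothesis f01 : forall t : nat, (0 < t)%N -> 0 <= f t%:R <= 1.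

Definition mean_nvert (n : nat) : R := 1 + \sum_(s < n) f s.+1%:R.

Lemma mean_nvertS n : mean_nvert n.+1 = mean_nvert n + f n.+1%:R.
Proof. by rewrite /mean_nvert big_ord_recr addrA. Qed.

Lemma mean_nvert_ge1 n : 1 <= mean_nvert n.
Proof.
by rewrite lerDl sumr_ge0 // => s _; have /andP[] := f01 (ltn0Sn s).
Qed.

Lemma avg_nvert t (g : mgraph) (x : R) (h : R -> R) : reachable t g ->
  avg x (fun g' => h (nvert g')%:R) g =
  x * h ((nvert g)%:R + 1) + (1 - x) * h (nvert g)%:R.
Proof.
move=> rg; rewrite (@avgE _ _ _ _ (fun=> h ((nvert g)%:R + 1)) (fun _ _ => h (nvert g)%:R)) //.
  by rewrite !(mean_cst _ rg).
by move=> v; rewrite nvert_add_vertex -natr1.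
Qed.

Lemma expect_nvert n :
  expect f 0 n (fun g => (nvert g)%:R) loop_graph <= mean_nvert n.
Proof.
elim: n => [|n IH]; first by rewrite /= /mean_nvert big_ord0 addr0.
rewrite expectSr mean_nvertS.
apply: (@le_trans _ _ (expect f 0 n (fun g => (nvert g)%:R + f n.+1%:R) loop_graph)).
  apply: (ler_expect f01 reachable_loop (extends_refl _)) => g rg _.
  by rewrite (avg_nvert _ id rg) add0n; lra.
by rewrite expectD (expect_cst f _ _ reachable_loop) lerD2r.
Qed.

(** The centred number of vertices is a martingale whose increment has variance [x * (1 - x)], at
    most [x]. *)
Lemma expect_nvert_var n :
  expect f 0 n (fun g => ((nvert g)%:R - mean_nvert n) ^+ 2) loop_graph <= mean_nvert n.
Proof.
elim: n => [|n IH].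
  by rewrite /= /mean_nvert big_ord0 addr0 subrr expr0n ler01.
rewrite expectSr mean_nvertS add0n.
have /andP[x0 x1] := f01 (ltn0Sn n); set x := f n.+1%:R in x0 x1 *.
apply: (@le_trans _ _ (expect f 0 n
    (fun g => ((nvert g)%:R - mean_nvert n) ^+ 2 + x) loop_graph)).
  apply: (ler_expect f01 reachable_loop (extends_refl _)) => g rg _.
  rewrite (avg_nvert _ (fun y => (y - (mean_nvert n + x)) ^+ 2) rg).
  have := mulr_ge0 x0 x0; rewrite !expr2.
  by set y := (nvert g)%:R; set M := mean_nvert n; clearbody x y M => *; lra.
by rewrite expectD (expect_cst f _ _ reachable_loop) lerD2r.
Qed.

(** If the clique number exceeds [L], either [k >= L / 3], or more than [2 * L / 3] clique members
    are late. In the second case [L >= 3] gives [a - 1 >= L / 3], so at least [L ^ 2 / 9] edges join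
    late vertices. *)
Lemma indicator_clique_gt (g : mgraph) (k : nat) (L : R) : 3 <= L ->
  (L < (clique_number g)%:R)%R%:R <=
  3 / L * k%:R + 9 / L ^+ 2 * (inner (fun i => (k <= i)%N) g)%:R :> R.
Proof.
move=> L3; have L0 : 0 < L by lra.
case: ltP => [h|_]; last by rewrite addr_ge0 ?mulr_ge0 ?invr_ge0 ?sqr_ge0 // ltW.
have [a wa aa] := clique_number_split g k.
have {}wa : (clique_number g)%:R <= k%:R + a%:R :> R by rewrite -natrD ler_nat.
move: aa; set X := inner _ _ => aa.
have k0 : 0 <= k%:R :> R by [].
have X0 : 0 <= X%:R :> R by [].
have [kL|kL] := leP (L / 3) k%:R.
  rewrite -[leLHS]addr0 lerD // ?mulr_ge0 ?invr_ge0 ?sqr_ge0 //.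
  by rewrite mulrAC ler_pdivlMr //= mul1r; lra.
case: a aa wa => [|a] aa wa; first by move: wa; rewrite addr0; lra.
have {}aa : a.+1%:R * a%:R <= 2 * X%:R :> R by rewrite -!natrM ler_nat.
apply: (@le_trans _ _ (9 / L ^+ 2 * X%:R)); last first.
  by rewrite lerDr mulr_ge0 // divr_ge0 // ltW.
rewrite mulrAC ler_pdivlMr ?exprn_gt0 //= mul1r.
move: aa wa; rewrite -natr1; set b := a%:R => aa wa.
have hb : L / 3 <= b by lra.
by rewrite expr2; nra.
Qed.

(** Conditioning on the graph at time [m], with its number of vertices as [k]. Markov's inequality
    is contained in the pointwise bound on the indicator. *)
Lemma expect_clique_gt m N (Theta L : R) :
  \sum_(u < N) f (m + u).+1%:R / (m + u).+2%:R <= Theta ->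
  (m.+1)%:R^-1 <= Theta -> 3 <= L ->
  expect f 0 (m + N) (fun g => (L < (clique_number g)%:R)%R%:R) loop_graph <=
  3 / L * mean_nvert m + 36 * (m + N).+1%:R * (Theta / L) ^+ 2.
Proof.
move=> hT mT L3; have L0 : 0 < L by lra.
rewrite expect_add add0n.
apply: (@le_trans _ _ (expect f 0 m (fun g => 3 / L * (nvert g)%:R +
    36 * (m + N).+1%:R * (Theta / L) ^+ 2) loop_graph)); last first.
  rewrite expectD (expect_cst f _ _ reachable_loop) lerD2r expectZ.
  by rewrite ler_wpM2l ?expect_nvert // divr_ge0 // ltW.
apply: (ler_expect f01 reachable_loop (extends_refl _)) => g; rewrite add0n => rg _.
apply: (@le_trans _ _ (expect f m N (fun g' => 3 / L * (nvert g)%:R +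
   9 / L ^+ 2 * (inner (fun i => (nvert g <= i)%N) g')%:R) g)).
  apply: (ler_expect f01 rg (extends_refl _)) => g' _ _.
  exact: indicator_clique_gt.
rewrite expectD (expect_cst f _ _ rg) lerD2l expectZ.
apply: le_trans (ler_wpM2l _ (expect_inner_le f01 rg hT mT)) _.
  by rewrite divr_ge0 // sqr_ge0.
rewrite le_eqVlt; apply/orP; left; apply/eqP.
by set y := (m + N).+1%:R; field; lra.
Qed.

End VertexCount.

(** * Many early vertices of high degree *)

Section Phi.
Context {R : realType}.

(* Equal to Gamma(D - 1/2) / (Gamma(1/2) Gamma(D)), of order D ^ (-1/2): the
   solution of D * (phi D - phi D.+1) = phi D / 2, so that phi (deg v) decays
   at a rate which does not depend on deg v.  The factor for k = 0 is 1, as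
   0^-1 = 0. *)
Definition phi (D : nat) : R := \prod_(k < D) (1 - (2 * k%:R)^-1).

Lemma phiS D : phi D.+1 = phi D * (1 - (2 * D%:R)^-1).
Proof. by rewrite /phi big_ord_recr. Qed.

Lemma phi_gt0 D : 0 < phi D.
Proof.
apply: prodr_gt0 => -[[|k] _] _ /=; first by rewrite mulr0 invr0 subr0.
rewrite subr_gt0 invf_lt1 ?mulr_gt0 ?ltr0n // -natr1.
by have := ler0n R k; lra.
Qed.

Lemma phi_le1 D : phi D <= 1.
Proof.
elim: D => [|D IH]; first by rewrite /phi big_ord0.
rewrite phiS; apply: le_trans IH; rewrite ler_piMr ?(ltW (phi_gt0 D)) //.
Qed.

(** From [D = 2] on, [(D - 1) * phi D ^ 2] is nondecreasing, and it starts at 1/4; the case [D = 1]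
    is direct since [phi 1 = 1]. *)
Lemma phi_sqr_ge D : (0 < D)%N -> 1 <= 4 * D%:R * phi D ^+ 2.
Proof.
case: D => [//|[_|D _]].
  by rewrite /phi big_ord1 /= mulr0 invr0 subr0; lra.
suff h : 1 <= 4 * D.+1%:R * phi D.+2 ^+ 2.
  by apply: le_trans h _; rewrite ler_wpM2r ?sqr_ge0 // ler_wpM2l // ler_nat.
elim: D => [|D IH].
  by rewrite 2!phiS /phi big_ord0 !mul1r mulr0 invr0 mulr1 subr0 mul1r; lra.
rewrite phiS; apply: le_trans IH _.
rewrite -[D.+2%:R]natr1; set x := D.+1%:R; set y := phi _.
have x1 : 1 <= x by rewrite ler1n.
have -> : 4 * (x + 1) * (y * (1 - (2 * (x + 1))^-1)) ^+ 2 =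
  4 * x * y ^+ 2 + y ^+ 2 / (x + 1) by field; lra.
by rewrite lerDl divr_ge0 ?sqr_ge0 //; lra.
Qed.

(** Makes [2 * r * phi] an upper bound for the indicator of a degree below [r ^ 2]. *)
Lemma phi_ge (D : nat) (r : R) : (0 < D)%N -> 0 < r -> D%:R < r ^+ 2 ->
  1 <= 2 * r * phi D.
Proof.
move=> D0 r0 Dr.
have p0 := phi_gt0 D; have h := phi_sqr_ge D0.
have h2 : D%:R * phi D ^+ 2 <= r ^+ 2 * phi D ^+ 2.
  by rewrite ler_wpM2r ?sqr_ge0 // ltW.
have s0 : 0 <= 2 * r * phi D by rewrite !mulr_ge0 // ltW.
rewrite leNgt; apply/negP => lt1.
have : (2 * r * phi D) ^+ 2 < 1 by rewrite expr_lt1.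
rewrite !exprMn; move: h h2; set a := phi D ^+ 2; set b := r ^+ 2; lra.
Qed.

(** A random end hits [i] with probability [D / (2 * (t + 1))] and then lowers [phi] by the fraction
    [1 / (2 * D)], so the degree cancels. The two ends of an edge-step give the main term; loops at
    [i] give the error of second order. *)
Lemma avg_phi t (g : mgraph) (x : R) (i : nat) : reachable t g -> (i < nvert g)%N ->
  0 <= x <= 1 ->
  avg x (fun g' => phi (degn g' i)) g <=
  phi (degn g i) * (1 - (1 - x) / (2 * t.+1%:R) + (t.+1%:R ^+ 2)^-1).
Proof.
move=> rg ig /andP[x0 x1]; set D := degn g i.
have D0 : 0 < D%:R :> R by rewrite ltr0n; exact: reachable_deg rg _ ig.
(* [a1] is the decrement of [phi] at [D]; [a2] is its second difference, which enters when an
   edge-step adds a loop at [i]. *)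
pose a1 := phi D / (2 * D%:R); pose a2 := phi D * (3 / 4) / (D%:R * (D%:R + 1)).
have phi1 : phi D.+1 = phi D - a1 by rewrite phiS /a1; field; lra.
have phi2 : phi D.+2 = phi D - 2 * a1 + a2.
  by rewrite 2!phiS /a1 /a2 -natr1; field; lra.
pose p := pred1 i.
rewrite (@avgE _ _ _ _ (fun j => phi D + (- a1) * (p j)%:R)
   (fun j l => (phi D + (- a1) * (p j)%:R) + (- a1 + a2 * (p j)%:R) * (p l)%:R));
   last 2 first.
- move=> v; rewrite /degn hits_add_vertex /= gtn_eqF // addn0 -/(degn g i) -/D.
  by case: eqP => _; rewrite ?addn1 ?addn0 ?phi1 /=; ring.
- move=> u v; rewrite /degn hits_add_edge /= -/(degn g i) -/D.
  by case: eqP => _; case: eqP => _; rewrite ?addn1 ?addn0 ?phi2 ?phi1 /=; ring.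
rewrite (mean_affine _ _ _ rg).
under [X in mean g X]eq_fun do rewrite (mean_affine _ _ _ rg).
set rho := dens g p.
rewrite (@eq_mean _ _ _ (fun j => (phi D - a1 * rho) + (- a1 + a2 * rho) * (p j)%:R));
  last by move=> j; ring.
rewrite (mean_affine _ _ _ rg) -/rho.
have rhoE : rho = D%:R / (2 * t.+1%:R) by rewrite /rho (densE _ rg) -[t.+1%:R]natr1.
set y := t.+1%:R in rhoE *; have y0 : 0 < y by rewrite ltr0n.
have e1 : a1 * rho = phi D / (4 * y) by rewrite /a1 rhoE; field; lra.
have e2 : a2 * rho ^+ 2 <= phi D * (y ^+ 2)^-1.
  have -> : a2 * rho ^+ 2 = phi D * (y ^+ 2)^-1 * (3 / 16 * (D%:R / (D%:R + 1))).
    by rewrite /a2 rhoE; field; lra.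
  rewrite ler_piMr ?mulr_ge0 ?invr_ge0 ?sqr_ge0 ?(ltW (phi_gt0 _)) //.
  have : D%:R / (D%:R + 1) <= 1 :> R by rewrite ler_pdivrMr; lra.
  by set z := D%:R / _; lra.
have z0 : 0 <= phi D / (4 * y) by rewrite divr_ge0 ?(ltW (phi_gt0 _)) //; lra.
have -> : phi D * (1 - (1 - x) / (2 * y) + (y ^+ 2)^-1) =
  phi D - 2 * (1 - x) * (phi D / (4 * y)) + phi D * (y ^+ 2)^-1 by field; lra.
have -> : x * (phi D + - a1 * rho) +
    (1 - x) * (phi D - a1 * rho + (- a1 + a2 * rho) * rho) =
  phi D - x * (a1 * rho) - 2 * (1 - x) * (a1 * rho) + (1 - x) * (a2 * rho ^+ 2).
  by ring.
rewrite e1.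
have h1 := mulr_ge0 x0 z0.
have : 0 <= a2 * rho ^+ 2.
  rewrite mulr_ge0 ?sqr_ge0 // /a2 divr_ge0 ?mulr_ge0 ?(ltW (phi_gt0 _)) //; lra.
set q := a2 * rho ^+ 2 in e2 *; set z := phi D / (4 * y) in z0 h1 *.
set w := phi D * _ in e2 *; clearbody q z w => q0.
have h2 := mulr_ge0 x0 q0; lra.
Qed.

End Phi.

(** * Degrees of the early vertices and missing edges between them *)

Section EarlyVertices.
Context {R : realType} (f : R -> R).
Hypothesis f01 : forall t : nat, (0 < t)%N -> 0 <= f t%:R <= 1.

Lemma expect_sum s n (I : Type) (r : seq I) (psi : I -> mgraph -> R) (g : mgraph) :
  reachable s g ->
  expect f s n (fun g' => \sum_(i <- r) psi i g') g =
  \sum_(i <- r) expect f s n (psi i) g.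
Proof.
move=> rg; elim: r => [|i r IH].
  rewrite big_nil -[RHS](expect_cst f n 0 rg); congr expect.
  by apply/funext => g'; rewrite big_nil.
rewrite big_cons -IH -expectD; congr expect.
by apply/funext => g'; rewrite big_cons.
Qed.

(** The product of [w] and [phi] of the degree is a supermartingale: [w] grows no faster than [phi]
    decays, at a rate made uniform by the bound [eps] on [f]. *)
Lemma expect_phi m n (g : mgraph) (eps : R) (w : nat -> R) (i : nat) :
  reachable m g -> (i < nvert g)%N ->
  (forall s, (m < s)%N -> f s%:R <= eps) ->
  (forall u, 0 <= w u) ->
  (forall u, (u < n)%N -> w u.+1 *
     (1 - (1 - eps) / (2 * (m + u).+1%:R) + ((m + u).+1%:R ^+ 2)^-1) <= w u) ->
  expect f m n (fun g' => phi (degn g' i)) g * w n <= phi (degn g i) * w 0%N.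
Proof.
move=> rg ig feps w0 wS.
rewrite [leLHS]mulrC -expectZ [leRHS]mulrC.
apply: (@expect_super _ f f01 m n (fun u g' => w u * phi (degn g' i)) g g) => //.
move=> u g' un rg' [ng _]; rewrite avgZ.
have ig' := leq_trans ig ng.
apply: le_trans (ler_wpM2l (w0 _) (avg_phi rg' ig' (f01 (ltn0Sn _)))) _.
rewrite mulrCA mulrC ler_wpM2r ?(ltW (phi_gt0 _)) //.
apply: le_trans (wS u un); rewrite ler_wpM2l // lerD2r lerD2l lerN2.
rewrite ler_wpM2r ?invr_ge0 ?mulr_ge0 // lerD2l lerN2 feps //; lia.
Qed.

Definition low_degree (k : nat) (r : R) (g : mgraph) : nat :=
  count (fun i => (degn g i)%:R < r ^+ 2) (iota 0 k).

(** Markov's inequality through [phi_ge], summed over the vertices of [g]; initially [phi] is at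
    most 1. *)
Lemma expect_low_degree m n (g : mgraph) (eps r : R) (w : nat -> R) :
  reachable m g -> 0 < r ->
  (forall s, (m < s)%N -> f s%:R <= eps) ->
  (forall u, 0 < w u) ->
  (forall u, (u < n)%N -> w u.+1 *
     (1 - (1 - eps) / (2 * (m + u).+1%:R) + ((m + u).+1%:R ^+ 2)^-1) <= w u) ->
  expect f m n (fun g' => (low_degree (nvert g) r g')%:R) g <=
  2 * r * (w 0%N / w n) * (nvert g)%:R.
Proof.
move=> rg r0 feps w0 wS; set k := nvert g.
apply: (@le_trans _ _ (expect f m n (fun g' =>
    2 * r * \sum_(i <- iota 0 k) phi (degn g' i)) g)).
  apply: (ler_expect f01 rg (extends_refl _)) => g' rg' [ng _].
  rewrite /low_degree -sum1_count natr_sum mulr_sumr big_mkcond /=.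
  rewrite big_seq [leRHS]big_seq; apply: ler_sum => i.
  rewrite mem_iota add0n => /andP[_ ik].
  have h : 0 <= 2 * r * phi (degn g' i) by rewrite !mulr_ge0 ?(ltW (phi_gt0 _)) // ltW.
  case: ifP => // hi; apply: phi_ge => //.
  by apply: (reachable_deg rg'); exact: leq_trans ik ng.
rewrite expectZ expect_sum // -[leRHS]mulrA ler_wpM2l ?mulr_ge0 ?(ltW r0) //.
rewrite -[X in _ * X%:R](size_iota 0 k) -sum1_size natr_sum mulr_sumr.
rewrite big_seq [leRHS]big_seq; apply: ler_sum => i.
rewrite mem_iota add0n => /andP[_ ik].
rewrite mulr1 ler_pdivlMr //.
apply: le_trans (expect_phi rg ik feps (fun u => ltW (w0 u)) wS) _.
by rewrite ler_piMl ?phi_le1 // ltW.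
Qed.

(** An edge-step draws [i] and then [j] with the product of their densities; a vertex-step cannot
    remove an edge. *)
Lemma avg_edge_absent t (g : mgraph) (x : R) (i j : nat) : reachable t g ->
  0 <= x <= 1 ->
  avg x (fun g' => ((i, j) \notin nedges g')%:R) g <=
  ((i, j) \notin nedges g)%:R *
    (1 - (1 - x) * (dens g (pred1 i) * dens g (pred1 j))).
Proof.
move=> rg /andP[x0 x1]; set b : R := (_ \notin nedges g)%:R.
apply: (@le_trans _ _ (x * b + (1 - x) * (b - b * (dens g (pred1 i) * dens g (pred1 j))))); last lra.
pose p := pred1 i; pose q := pred1 j.
rewrite /avg; apply: lerD.
  rewrite ler_wpM2l // -[leRHS](mean_cst b rg) /mean.
  apply: ler_sum => v _; rewrite ler_wpM2l ?pi_deg_ge0 // nedges_add_vertex.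
  by rewrite mem_rcons inE negb_or /b ler_nat; case: (_ \notin nedges g); rewrite ?andbF ?leq_b1.
rewrite ler_wpM2l ?subr_ge0 //.
have -> : b - b * (dens g p * dens g q) =
    mean g (fun u => mean g (fun v => b + (- b * (p u)%:R) * (q v)%:R)).
  under [X in mean g X]eq_fun do rewrite (mean_affine _ _ _ rg).
  rewrite (@eq_mean _ _ _ (fun u => b + (- b * dens g q) * (p u)%:R)); last by move=> u; ring.
  by rewrite (mean_affine _ _ _ rg); ring.
rewrite /mean; apply: ler_sum => u _; rewrite mulr_sumr; apply: ler_sum => v _.
rewrite -mulrA ler_wpM2l ?pi_deg_ge0 // ler_wpM2l ?pi_deg_ge0 //.
rewrite nedges_add_edge mem_rcons inE negb_or /b xpair_eqE /p /q /= ![_ == i]eq_sym ![_ == j]eq_sym.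
by case: (i == u); case: (j == v); case: (_ \notin nedges g);
  rewrite ?(mulr0n, mulr1n, mulr0, mulr1, subr0, addr0, subrr, oppr0, mul0r, addNr) //= ?mulr1 ?subrr ?mulr0 ?addr0.
Qed.

Lemma expect_edge_absent s n (g0 : mgraph) (i j : nat) (q : R) : reachable s g0 ->
  0 <= q <= 1 ->
  (forall u g, (u < n)%N -> reachable (s + u) g -> extends g0 g ->
     q <= (1 - f (s + u).+1%:R) * (dens g (pred1 i) * dens g (pred1 j))) ->
  expect f s n (fun g => ((i, j) \notin nedges g)%:R) g0 <= (1 - q) ^+ n.
Proof.
move=> rg /andP[q0 q1]; elim: n => [|n IH] hq; first by rewrite /= expr0 -[leRHS]/1%:R ler_nat leq_b1.
rewrite expectSr exprS.
apply: (@le_trans _ _ (expect f s n (fun g => (1 - q) * ((i, j) \notin nedges g)%:R) g0)).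
  apply: (ler_expect f01 rg (extends_refl _)) => g rg' eg.
  apply: le_trans (avg_edge_absent _ _ rg' (f01 (ltn0Sn _))) _.
  by rewrite mulrC ler_wpM2r // lerD2l lerN2 hq.
rewrite expectZ ler_wpM2l ?subr_ge0 // IH // => u g un; apply: hq; exact: ltnW.
Qed.

End EarlyVertices.

Lemma leq_clique_number (g : mgraph) (s : seq nat) : uniq s ->
  {in s, forall i, (i < nvert g)%N} ->
  {in s &, forall i j, i != j -> (i, j) \in nedges g} ->
  (size s <= clique_number g)%N.
Proof.
move=> us sn se; pose A := [set v : 'I_(nvert g) | val v \in s].
have cA : is_clique A.
  apply/forall_inP => u; rewrite inE => us'; apply/forall_inP => v; rewrite inE => vs.
  apply/implyP => uv; rewrite /Defs.adjacent.
  have /mapP[[a b] h [ea eb]] := se _ _ us' vs uv.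
  by rewrite (val_inj ea) (val_inj eb) h.
apply: leq_trans (leq_bigmax_cond _ cA).
rewrite cardE -(size_map val) uniq_leq_size // => i hi.
apply/mapP; exists (Ordinal (sn _ hi)) => //.
by rewrite mem_enum inE.
Qed.

(** * Lower bound for the clique number *)

Section CliqueLowerTail.
Context {R : realType} (f : R -> R).
Hypothesis f01 : forall t : nat, (0 < t)%N -> 0 <= f t%:R <= 1.

Definition high_degree (k : nat) (r : R) (g : mgraph) : seq nat :=
  [seq i <- iota 0 k | r ^+ 2 <= (degn g i)%:R].

Lemma size_high_degree k r g : (size (high_degree k r g) + low_degree k r g)%N = k.
Proof.
rewrite /high_degree /low_degree size_filter -[RHS](size_iota 0 k).
rewrite -(count_predC (fun i => r ^+ 2 <= (degn g i)%:R)); congr addn.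
by apply: eq_count => i /=; rewrite ltNge.
Qed.

(** Ordered pairs: an edge is demanded in each orientation, which costs only a constant factor in
    the union bound. *)
Definition high_pairs (k : nat) (r : R) (g : mgraph) : seq (nat * nat) :=
  [seq e <- [seq (i, j) | i <- high_degree k r g, j <- high_degree k r g] | e.1 != e.2].

Lemma size_high_pairs k r g : (size (high_pairs k r g) <= k ^ 2)%N.
Proof.
rewrite size_filter; apply: leq_trans (count_size _ _) _.
rewrite size_allpairs; have := size_high_degree k r g; nia.
Qed.

(** If [k >= 2 * L], at most half of the [k] vertices have low degree in [g0], and no pair is
    missing in [g], then the others form a clique of size at least [L]. Each term on the right pays
    for the failure of one condition. *)
Lemma indicator_clique_lt (k : nat) (r L : R) (g0 g : mgraph) : (k <= nvert g)%N ->
  ((clique_number g)%:R < L)%R%:R <=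
  (k%:R < 2 * L)%R%:R + 2 / k%:R * (low_degree k r g0)%:R +
  \sum_(e <- high_pairs k r g0) (e \notin nedges g)%:R :> R.
Proof.
move=> kg.
have -> : \sum_(e <- high_pairs k r g0) (e \notin nedges g)%:R =
    (count (fun e => e \notin nedges g) (high_pairs k r g0))%:R :> R.
  rewrite -sum1_count natr_sum [RHS]big_mkcond /=; apply: eq_bigr => e _.
  by case: (_ \notin _).
set low := low_degree k r g0; set c := count _ _.
have l0 : 0 <= 2 / k%:R * low%:R :> R by rewrite mulr_ge0 // divr_ge0.
have c0 : 0 <= c%:R :> R by [].
case: ltP => [wL|_]; last by rewrite !addr_ge0.
case: ltP => [_|kL] /=; first by rewrite -addrA lerDl addr_ge0.
rewrite add0r; have [lk|lk] := ltnP k (2 * low).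
  rewrite -[leLHS]addr0 lerD // mulrAC ler_pdivlMr; last first.
    by rewrite ltr0n; have := size_high_degree k r g0; rewrite -/low; lia.
  by rewrite mul1r -natrM ler_nat ltnW.
rewrite -[leLHS]add0r lerD // -[leLHS]/1%:R ler_nat lt0n; apply/negP => /eqP c0'.
have hs := size_high_degree k r g0; rewrite -/low in hs.
suff : (size (high_degree k r g0) <= clique_number g)%N.
  rewrite -(@ler_nat R) => h.
  have : k%:R <= 2 * (size (high_degree k r g0))%:R :> R by rewrite -natrM ler_nat; lia.
  by move: kL wL h; lra.
apply: leq_clique_number => [|i|i j hi hj ij].
- by rewrite filter_uniq // iota_uniq.
- by rewrite mem_filter mem_iota add0n => /andP[_ /andP[_ ik]]; exact: leq_trans ik kg.
have h : (i, j) \in high_pairs k r g0.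
  by rewrite mem_filter /= ij; apply/allpairsP; exists (i, j).
apply/negPn/negP => hn.
have : has (fun e => e \notin nedges g) (high_pairs k r g0) by apply/hasP; exists (i, j).
by rewrite has_count -/c c0'.
Qed.

(** Degrees never decrease, so the chosen vertices keep density at least [r ^ 2 / (2 * (s + n))],
    and each step is an edge-step with probability at least 1/2; this is the origin of [q]. *)
Lemma expect_clique_lt_cond s n k (r L q : R) (g0 : mgraph) : reachable s g0 ->
  (k <= nvert g0)%N -> 0 <= q <= 1 ->
  (forall u, (u < n)%N -> f (s + u).+1%:R <= 1 / 2) ->
  q <= 1 / 2 * (r ^+ 2 / (2 * (s + n)%:R)) ^+ 2 ->
  expect f s n (fun g => ((clique_number g)%:R < L)%R%:R) g0 <=
  (k%:R < 2 * L)%R%:R + 2 / k%:R * (low_degree k r g0)%:R + k%:R ^+ 2 * (1 - q) ^+ n.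
Proof.
move=> rg kg q01 fh hq; have /andP[q0 q1] := q01.
apply: le_trans (ler_expect f01 rg (extends_refl _)
   (chi := fun g => (k%:R < 2 * L)%R%:R + 2 / k%:R * (low_degree k r g0)%:R +
  \sum_(e <- high_pairs k r g0) (e \notin nedges g)%:R) _) _.
  by move=> g _ [ng _]; apply: indicator_clique_lt; exact: leq_trans kg ng.
rewrite expectD (expect_cst f _ _ rg) lerD2l expect_sum //.
apply: (@le_trans _ _ (\sum_(e <- high_pairs k r g0) (1 - q) ^+ n)); last first.
  rewrite big_const_seq iter_addr_0 count_predT -[leLHS]mulr_natl.
  rewrite ler_wpM2r ?exprn_ge0 ?subr_ge0 // -natrX ler_nat.
  exact: size_high_pairs.
rewrite big_seq [leRHS]big_seq; apply: ler_sum => -[i j] hij.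
apply: (expect_edge_absent f01 rg q01) => u g un rg' [_ dg].
have [hi hj] : r ^+ 2 <= (degn g i)%:R /\ r ^+ 2 <= (degn g j)%:R :> R.
  move: hij; rewrite mem_filter => /andP[_ /allpairsP[[a b] /= [ha hb [-> ->]]]].
  move: ha hb; rewrite !mem_filter => /andP[ha _] /andP[hb _].
  by split; [apply: le_trans ha _|apply: le_trans hb _]; rewrite ler_nat.
set y : R := 2 * (s + n)%:R in hq *.
have y0 : 0 < y by rewrite mulr_gt0 // ltr0n; lia.
have dens_ge l : r ^+ 2 <= (degn g l)%:R -> r ^+ 2 / y <= dens g (pred1 l).
  move=> hl; rewrite (densE _ rg') natr1.
  apply: ler_pM; rewrite ?sqr_ge0 ?invr_ge0 ?(ltW y0) //.
  rewrite lef_pV2 ?posrE ?mulr_gt0 ?ltr0n //; last lia.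
  by rewrite ler_wpM2l // ler_nat; lia.
have r0 : 0 <= r ^+ 2 / y by rewrite divr_ge0 ?sqr_ge0 // ltW.
apply: le_trans hq _; apply: ler_pM; rewrite ?sqr_ge0 //.
  by have := fh u un; lra.
by rewrite expr2; apply: ler_pM => //; exact: dens_ge.
Qed.

(** Three phases: [m] steps create vertices, [n1] steps raise their degrees, [n2] steps join them.
    The errors come from Chebyshev's inequality for fewer than half the mean number of vertices,
    from low degrees, and from the union bound over at most [(m + 1) ^ 2] pairs. *)
Lemma expect_clique_lt m n1 n2 (eps r L q : R) (w : nat -> R) :
  0 < r -> eps <= 1 / 2 ->
  (forall s, (m < s)%N -> f s%:R <= eps) ->
  (forall u, 0 < w u) ->
  (forall u, (u < n1)%N -> w u.+1 *
     (1 - (1 - eps) / (2 * (m + u).+1%:R) + ((m + u).+1%:R ^+ 2)^-1) <= w u) ->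
  0 <= q <= 1 -> q <= 1 / 2 * (r ^+ 2 / (2 * (m + n1 + n2)%:R)) ^+ 2 ->
  4 * L <= mean_nvert f m ->
  expect f 0 (m + n1 + n2) (fun g => ((clique_number g)%:R < L)%R%:R) loop_graph <=
  4 / mean_nvert f m + 4 * r * (w 0%N / w n1) + (m.+1)%:R ^+ 2 * (1 - q) ^+ n2.
Proof.
move=> r0 eps2 feps w0 wS q01 hq LF; have /andP[q0 q1] := q01.
set F := mean_nvert f m in LF *.
have F1 : 1 <= F := mean_nvert_ge1 f01 m.
rewrite -addnA expect_add add0n.
set tail := 4 * r * (w 0%N / w n1) + (m.+1)%:R ^+ 2 * (1 - q) ^+ n2.
apply: (@le_trans _ _ (expect f 0 m (fun g => 4 / F ^+ 2 * ((nvert g)%:R - F) ^+ 2 + tail)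
    loop_graph)); last first.
  rewrite expectD (expect_cst f _ _ reachable_loop) -addrA lerD2r expectZ.
  apply: le_trans (ler_wpM2l _ (expect_nvert_var f01 m)) _.
    by rewrite divr_ge0 ?sqr_ge0.
  by rewrite -/F le_eqVlt; apply/orP; left; apply/eqP; field; lra.
apply: (ler_expect f01 reachable_loop (extends_refl _)) => g0; rewrite add0n => rg _.
set k := nvert g0; set W := w 0%N / w n1.
have h1 : (k%:R < 2 * L)%R%:R <= 4 / F ^+ 2 * (k%:R - F) ^+ 2 :> R.
  case: ltP => [kL|_]; last by rewrite mulr_ge0 ?divr_ge0 ?sqr_ge0.
  rewrite mulrAC ler_pdivlMr ?exprn_gt0 //=; last lra.
  have kF : F / 2 <= F - k%:R by lra.
  by rewrite mul1r !expr2; nra.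
have h2 : k%:R ^+ 2 * (1 - q) ^+ n2 <= (m.+1)%:R ^+ 2 * (1 - q) ^+ n2.
  rewrite ler_wpM2r ?exprn_ge0 ?subr_ge0 // ler_pXn2r ?nnegrE // ler_nat.
  exact: reachable_nvert rg.
apply: (@le_trans _ _ (expect f m n1 (fun g => ((k%:R < 2 * L)%R%:R +
    k%:R ^+ 2 * (1 - q) ^+ n2) + 2 / k%:R * (low_degree k r g)%:R) g0)).
  rewrite expect_add.
  apply: (ler_expect f01 rg (extends_refl _)) => g rg' [ng _].
  rewrite addrAC; apply: (expect_clique_lt_cond _ rg' ng q01) => //.
  by move=> u _; apply: le_trans eps2; apply: feps; lia.
rewrite expectD (expect_cst f _ _ rg) expectZ.
have h3 : 2 / k%:R * expect f m n1 (fun g => (low_degree k r g)%:R) g0 <= 4 * r * W.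
  apply: le_trans (ler_wpM2l _ (expect_low_degree f01 rg r0 feps w0 wS)) _.
    by rewrite divr_ge0.
  rewrite -/k -/W.
  have W0 : 0 <= 4 * r * W.
    apply: mulr_ge0; first by rewrite mulr_ge0 // ltW.
    by rewrite /W divr_ge0 // ltW.
  have [->|k0] := eqVneq k%:R (0 : R); first by rewrite !mulr0.
  by rewrite le_eqVlt; apply/orP; left; apply/eqP; field.
by rewrite /tail -/W; lra.
Qed.

End CliqueLowerTail.

(** * Asymptotics *)

Section RealEstimates.
Context {R : realType}.
Implicit Types x y : R.

Lemma powR_add x r s : 0 < x -> x `^ (r + s) = x `^ r * x `^ s.
Proof. by move=> x0; rewrite powRD // (gt_eqF x0) implybT. Qed.

Lemma powR_ge1 x r : 1 <= x -> 0 <= r -> 1 <= x `^ r.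
Proof. by move=> x1 r0; rewrite -(powRr0 x) ler_powR. Qed.

Lemma ltr_powRr x r s : 1 < x -> r < s -> x `^ r < x `^ s.
Proof.
move=> x1 rs; rewrite /powR gt_eqF ?(lt_trans _ x1) // ltr_expR.
by rewrite ltr_pM2r // ln_gt0.
Qed.

Lemma powR_le_anti x y r : 0 < x -> x <= y -> r <= 0 -> y `^ r <= x `^ r.
Proof.
move=> x0 xy r0; have y0 := lt_le_trans x0 xy.
rewrite -(opprK r) !(powRN _ (- r)) lef_pV2 ?posrE ?powR_gt0 //.
by rewrite ge0_ler_powR ?nnegrE ?oppr_ge0 // ltW.
Qed.

(** From [ln y < y] at the power [nu] of [x]. It converts the errors, negative powers of the time,
    into multiples of the inverse logarithm. *)
Lemma powRN_le_ln x nu : 1 < x -> 0 < nu -> x `^ (- nu) <= nu^-1 / ln x.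
Proof.
move=> x1 nu0; have l0 := ln_gt0 x1; have x0 : 0 < x by lra.
have h : nu * ln x < x `^ nu by rewrite -ln_powR ln_sublinear // powR_gt0.
rewrite powRN -invfM lef_pV2 ?posrE ?powR_gt0 ?mulr_gt0 //.
exact: ltW.
Qed.

Lemma ln_le_powR x nu : 1 <= x -> 0 < nu -> 1 + ln x <= (1 + nu^-1) * x `^ nu.
Proof.
move=> x1 nu0; have x0 : 0 < x by lra.
have h : nu * ln x < x `^ nu by rewrite -ln_powR ln_sublinear // powR_gt0.
have h1 := powR_ge1 x1 (ltW nu0).
rewrite mulrDl mul1r lerD // mulrC ler_pdivlMr // mulrC; exact: ltW.
Qed.

(** [expR x] is the power [p] of [expR (x / p)], which is at least [x / p]. *)
Lemma expRN_le x p : 0 < x -> 0 < p -> expR (- x) <= (x / p) `^ (- p).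
Proof.
move=> x0 p0; rewrite expRN powRN lef_pV2 ?posrE ?expR_gt0 ?powR_gt0 ?divr_gt0 //.
have -> : expR x = expR (x / p) `^ p by rewrite -expRM divfK // gt_eqF.
rewrite ge0_ler_powR ?nnegrE ?divr_ge0 ?expR_ge0 ?ltW //.
by have := expR_ge1Dx (x / p); lra.
Qed.

(** Induction with [ln (1 - z) <= - z] at [z = 1 / (n + 2)]; the case [n = 0] rests on the
    convention [ln 0 = 0]. *)
Lemma harmonic_le n : \sum_(s < n) (s.+1%:R)^-1 <= 1 + ln n%:R :> R.
Proof.
case: n => [|n]; first by rewrite big_ord0 ln0 // addr0.
elim: n => [|n IH]; first by rewrite big_ord1 ln1 addr0 invr1.
rewrite big_ord_recr /=; apply: (@le_trans _ _ (1 + ln n.+1%:R + n.+2%:R^-1)).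
  by rewrite lerD2r.
rewrite -addrA lerD2l.
have y0 : 0 < n.+1%:R :> R by rewrite ltr0n.
have z0 : 0 < n.+2%:R :> R by rewrite ltr0n.
have -> : ln n.+1%:R = ln n.+2%:R + ln (1 + - n.+2%:R^-1) :> R.
  rewrite -lnM ?posrE //; first congr ln.
    by rewrite -[n.+2%:R]natr1; field; lra.
  by rewrite subr_gt0 invf_lt1 // ltr1n.
have : ln (1 + - n.+2%:R^-1) <= - n.+2%:R^-1 :> R.
  by apply: le_ln1Dx; rewrite ltrN2 invf_lt1 // ltr1n.
set a := ln (1 + _); set b := n.+2%:R^-1; set c := ln _; clearbody a b c; lra.
Qed.

Lemma ln_nat_ge0 n : 0 <= ln n%:R :> R.
Proof. by case: n => [|n]; [rewrite ln0|rewrite ln_ge0 // ler1n]. Qed.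

Lemma ler_ln_nat n t : (n <= t)%N -> ln n%:R <= ln t%:R :> R.
Proof.
case: n => [|n] nt; first by rewrite ln0 // ln_nat_ge0.
by rewrite ler_ln ?posrE ?ltr0n ?ler_nat // (leq_trans _ nt).
Qed.

(* The factor expR ((m + u)%:R^-1) absorbs the summable error terms. *)
Definition weight (m : nat) (theta : R) (u : nat) : R :=
  (m + u).+1%:R `^ theta * expR ((m + u)%:R^-1).

Lemma weight_gt0 m theta u : 0 < weight m theta u.
Proof. by rewrite mulr_gt0 ?expR_gt0 ?powR_gt0 ?ltr0n. Qed.

(** All factors are bounded by exponentials through [1 + z <= expR z]. With [y = m + u + 1] the
    exponents [theta / y] cancel, and [1 / y + 1 / y ^ 2 <= 1 / (y - 1)] remains. *)
Lemma weight_step m theta u : (0 < m)%N -> 0 <= theta ->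
  weight m theta u.+1 *
    (1 - theta / (m + u).+1%:R + ((m + u).+1%:R ^+ 2)^-1) <= weight m theta u.
Proof.
move=> m0 th0; rewrite /weight addnS.
set n := (m + u)%N; have n0 : 0 < n%:R :> R by rewrite ltr0n /n; lia.
rewrite -[n.+2%:R]natr1 -[n.+1%:R]natr1; set y : R := n%:R + 1.
have y1 : 1 < y by rewrite /y; lra.
have nE : n%:R = y - 1 :> R by rewrite /y; lra.
rewrite nE.
have h1 : 1 - theta / y + (y ^+ 2)^-1 <= expR (- (theta / y) + (y ^+ 2)^-1).
  by have := expR_ge1Dx (- (theta / y) + (y ^+ 2)^-1); lra.
have h2 : (y + 1) `^ theta <= y `^ theta * expR (theta / y).
  have -> : y + 1 = y * (1 + y^-1) by field; lra.
  rewrite powRM ?addr_ge0 ?invr_ge0 //; try lra.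
  rewrite ler_wpM2l ?powR_ge0 // mulrC expRM.
  rewrite ge0_ler_powR ?nnegrE ?expR_ge0 ?expR_ge1Dx //.
  by rewrite addr_ge0 // invr_ge0; lra.
apply: (@le_trans _ _ ((y + 1) `^ theta * expR (y^-1) * expR (- (theta / y) + (y ^+ 2)^-1))).
  by rewrite ler_wpM2l // mulr_ge0 ?powR_ge0 ?expR_ge0.
apply: (@le_trans _ _ (y `^ theta * expR (theta / y) * expR (y^-1) *
    expR (- (theta / y) + (y ^+ 2)^-1))).
  by rewrite !ler_wpM2r ?expR_ge0.
rewrite -!mulrA ler_wpM2l ?powR_ge0 // -!expRD ler_expR.
have -> : theta / y + (y^-1 + (- (theta / y) + (y ^+ 2)^-1)) = y^-1 + (y ^+ 2)^-1 by ring.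
have -> : (y - 1)^-1 = y^-1 + (y ^+ 2)^-1 + (y ^+ 2 * (y - 1))^-1 by field; lra.
by rewrite lerDl invr_ge0 mulr_ge0 ?sqr_ge0 //; lra.
Qed.

Lemma weight_ratio_le (m n : nat) (theta : R) : (0 < m)%N -> 0 <= theta ->
  weight m theta 0 / weight m theta n <=
  expR 1 * (m.+1%:R / (m + n).+1%:R) `^ theta.
Proof.
move=> m0 th0; rewrite /weight addn0.
have M0 : 0 < m.+1%:R :> R by rewrite ltr0n.
have N0 : 0 < (m + n).+1%:R :> R by rewrite ltr0n.
have hN : ((m + n).+1%:R^-1) `^ theta = ((m + n).+1%:R `^ theta)^-1.
  by rewrite -(powR_inv1 (ltW N0)) -powRrM mulN1r powRN.
rewrite powRM ?invr_ge0 ?(ltW M0) ?(ltW N0) // hN.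
have a0 : 0 < (m + n).+1%:R `^ theta by exact: powR_gt0.
have e1 : expR (m%:R^-1) <= expR 1 :> R.
  by rewrite ler_expR invf_le1 ?ltr0n // ler1n.
have e2 : 1 <= expR ((m + n)%:R^-1) :> R.
  by rewrite -expR0 ler_expR invr_ge0.
rewrite ler_pdivrMr ?mulr_gt0 ?expR_gt0 //.
set x := _ `^ theta; set y := _ `^ theta in a0 *.
set E := expR _ in e1 *; set E' := expR _ in e2 *.
have x0 : 0 <= x by exact: powR_ge0.
have -> : expR 1 * (x / y) * (y * E') = x * expR 1 * E' by field; lra.
rewrite -[leLHS]mulr1 ler_pM ?mulr_ge0 ?expR_ge0 //.
by rewrite ler_wpM2l.
Qed.

(** The weight ratio has exponent [(a - 1) * (1 - eta) / 2], and the degree threshold lies a factor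
    [T ^ (2 * eta)] below [T ^ (1 - a)]. The exponents add up to [- eta + (1 - a) * eta / 2]. *)
Lemma degree_term_le (T a eta : R) (m n : nat) :
  1 < T -> 0 <= a -> 0 < eta <= 1 -> (0 < m)%N ->
  m.+1%:R <= 2 * T `^ a -> T / 2 <= (m + n)%:R ->
  4 * T `^ ((1 - a) / 2 - eta) *
    (weight m ((1 - eta) / 2) 0 / weight m ((1 - eta) / 2) n) <=
  16 * expR 1 * T `^ (- (eta / 2)).
Proof.
move=> T1 a0 /andP[eta0 eta1] m0 M2 nT; have T0 : 0 < T by lra.
set theta := (1 - eta) / 2.
have th0 : 0 <= theta by rewrite /theta; lra.
have th1 : theta <= 1 by rewrite /theta; lra.
have hW : weight m theta 0 / weight m theta n <= expR 1 * (4 * T `^ ((a - 1) * theta)).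
  apply: (le_trans (weight_ratio_le n m0 th0)); rewrite ler_wpM2l ?expR_ge0 //.
  apply: (@le_trans _ _ ((4 * T `^ (a - 1)) `^ theta)).
    have z0 : 0 <= 4 * T `^ (a - 1) by rewrite mulr_ge0 ?powR_ge0.
    apply: (ge0_ler_powR th0); rewrite ?nnegrE //.
    have TV : T `^ (a - 1) = T `^ a * T^-1 by rewrite powR_add // powR_inv1 // ltW.
    rewrite TV ler_pdivrMr ?ltr0n //; apply: (le_trans M2).
    have N2 : T / 2 <= (m + n).+1%:R by rewrite -[(m + n).+1%:R]natr1; lra.
    have k0 : 0 <= 4 * (T `^ a * T^-1).
      by rewrite mulr_ge0 // mulr_ge0 ?powR_ge0 // invr_ge0 ltW.
    apply: le_trans (ler_wpM2l k0 N2).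
    by rewrite le_eqVlt; apply/orP; left; apply/eqP; field; lra.
  rewrite powRM ?powR_ge0 // -powRrM ler_wpM2r ?powR_ge0 //.
  by apply: ler1_powR => //; lra.
set r := T `^ _.
have r0 : 0 <= 4 * r by rewrite mulr_ge0 ?powR_ge0.
apply: le_trans (ler_wpM2l r0 hW) _.
have -> : 4 * r * (expR 1 * (4 * T `^ ((a - 1) * theta))) =
    16 * expR 1 * (r * T `^ ((a - 1) * theta)) by ring.
rewrite ler_wpM2l ?mulr_ge0 ?expR_ge0 // /r -powR_add //.
apply: ler_powR; first exact: ltW.
have -> : (1 - a) / 2 - eta + (a - 1) * theta = - eta + (1 - a) * eta / 2.
  by rewrite /theta; field.
have : (1 - a) * eta <= 1 * eta by rewrite ler_wpM2r ?(ltW eta0) //; lra.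
lra.
Qed.

(** The power is at most [expR (- (T ^ kappa / 24))], which [expRN_le] with [p = 2 / kappa] bounds
    by a multiple of [T ^ (-2)]; the number of pairs is at most [4 * T]. *)
Lemma pairs_term_le (T a kappa : R) (m n : nat) :
  1 < T -> a <= 1 / 2 -> 0 < kappa <= 1 ->
  m.+1%:R <= 2 * T `^ a -> T / 3 <= n%:R ->
  m.+1%:R ^+ 2 * (1 - T `^ (kappa - 1) / 8) ^+ n <=
  4 * (24 * (2 / kappa))^-1 `^ (- (2 / kappa)) * T `^ (- 1).
Proof.
move=> T1 a1 /andP[k0 k1] M2 nT; have T0 : 0 < T by lra.
set p := 2 / kappa; set K0 := _ `^ (- p); set q := _ / 8.
have p0 : 0 < p by rewrite divr_gt0.
have q0 : 0 <= q by rewrite divr_ge0 ?powR_ge0.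
have q1 : 0 <= 1 - q.
  rewrite subr_ge0 ler_pdivrMr // mul1r.
  have : T `^ (kappa - 1) <= T `^ 0 by apply: ler_powR; lra.
  by rewrite powRr0; lra.
have qn : (1 - q) ^+ n <= expR (- (T `^ kappa / 24)).
  apply: (@le_trans _ _ (expR (- q) ^+ n)).
    by apply: lerXn2r; rewrite ?nnegrE ?expR_ge0 ?expR_ge1Dx.
  rewrite -expRM_natr ler_expR mulNr lerN2.
  apply: le_trans (ler_wpM2l q0 nT).
  have -> : T `^ kappa = T `^ (kappa - 1) * T `^ 1.
    by rewrite -powR_add //; congr (_ `^ _); ring.
  by rewrite powRr1 ?(ltW T0) // /q le_eqVlt; apply/orP; left; apply/eqP; field.
have K1 : expR (- (T `^ kappa / 24)) <= K0 * T `^ (- 2).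
  have x0 : 0 < T `^ kappa / 24 by rewrite divr_gt0 ?powR_gt0.
  apply: (le_trans (expRN_le x0 p0)).
  have -> : T `^ kappa / 24 / p = (24 * p)^-1 * T `^ kappa by field; lra.
  have i0 : 0 <= (24 * p)^-1 by rewrite invr_ge0 mulr_ge0 // ltW.
  rewrite (powRM _ i0 (powR_ge0 _ _)) -powRrM.
  rewrite le_eqVlt; apply/orP; left; apply/eqP; congr (_ * _ `^ _).
  by rewrite /p; field; lra.
have M4 : m.+1%:R ^+ 2 <= 4 * T.
  apply: (@le_trans _ _ ((2 * T `^ a) ^+ 2)).
    by apply: lerXn2r; rewrite ?nnegrE ?mulr_ge0 ?powR_ge0.
  have -> : (2 * T `^ a) ^+ 2 = 4 * T `^ (a + a) by rewrite powR_add //; ring.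
  by rewrite ler_wpM2l // -[leRHS](powRr1 (ltW T0)) ler_powR ?(ltW T1) //; lra.
have h2 := le_trans qn K1.
have q2 : 0 <= (1 - q) ^+ n by rewrite exprn_ge0.
apply: le_trans (ler_pM (sqr_ge0 _) q2 M4 h2) _.
have -> : T `^ (- 2) = T `^ (-1) * T `^ (-1) by rewrite -powR_add //; congr (_ `^ _); ring.
rewrite powR_inv1 ?(ltW T0) // le_eqVlt; apply/orP; left; apply/eqP; field.
lra.
Qed.

Lemma le_quarter_sqr (z y : R) : 0 <= z -> z * z = y -> 16 <= y -> z <= y / 4.
Proof.
move=> z0 <- z16; have z4 : 4 <= z by rewrite leNgt; apply/negP => z4; nra.
nra.
Qed.

End RealEstimates.

(** The last half of the time is kept for joining pairs; the factor 3 allows for rounding. *)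
Lemma split_time (t m : nat) : (16 <= t)%N -> (4 * m <= t)%N ->
  exists n1 n2, [/\ m + n1 + n2 = t, t <= 2 * (m + n1) & t <= 3 * n2]%N.
Proof. by move=> t16 mt; exists (t - t./2 - m)%N, t./2; split; lia. Qed.

(** * Potter's bounds for regularly varying functions *)

Section Potter.
Context {R : realType} (f : R -> R) (gamma : R).
Hypothesis f_range : forall x : R, 0 < x -> 0 < f x <= 1.
Hypothesis f_decr : decreases_to_zero f.
Hypothesis gamma_ge0 : 0 <= gamma.
Hypothesis f_rv : regularly_varying f (- gamma).

(** Regular variation at the factor 2, to be iterated. *)
Lemma doubling (eps : R) : 0 < eps -> exists2 T : R, 1 <= T &
  forall x, T <= x -> 2 `^ (- gamma - eps) * f x <= f (2 * x) <= 2 `^ (- gamma + eps) * f x.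
Proof.
move=> e0; have [fpos /(_ 2 (ltr0Sn _ 1)) cv] := f_rv.
have lt12 : (1 : R) < 2 by lra.
have [|M1 [_ h1]] := cvgr_lt _ cv (2 `^ (- gamma + eps)).
  by apply: ltr_powRr => //; lra.
have [|M2 [_ h2]] := cvgr_gt _ cv (2 `^ (- gamma - eps)).
  by apply: ltr_powRr => //; lra.
exists (Num.max 1 (Num.max (M1 + 1) (M2 + 1))); first by rewrite le_max lexx.
move=> x; rewrite !ge_max => /and3P[x1 x2 x3].
have f0 : 0 < f x by apply: fpos; lra.
have /h1/= : M1 < x by lra.
have /h2/= : M2 < x by lra.
by rewrite ltr_pdivlMr // ltr_pdivrMr // => /ltW -> /ltW ->.
Qed.

(** Induction on the number of halvings that bring [x] below [2 * T]. There [f <= 1], and the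
    constant is chosen to make the right side at least 1. *)
Lemma potter_upper (eps : R) : 0 < eps ->
  exists2 C : R, 0 < C & forall x, 1 <= x -> f x <= C * x `^ (- gamma + eps).
Proof.
move=> e0; have [T T1 hT] := doubling e0.
set T2 := 2 * T; have T20 : 1 <= T2 by rewrite /T2; lra.
exists (T2 `^ gamma); first by apply: powR_gt0; lra.
suff main n x : 1 <= x -> x <= 2 ^+ n * T2 -> f x <= T2 `^ gamma * x `^ (- gamma + eps).
  move=> x x1; apply: (main (Num.bound x)) => //.
  apply: (@le_trans _ _ (2 ^+ Num.bound x)); last by rewrite ler_peMr ?exprn_ge0.
  have := archi_boundP (ltW (lt_le_trans ltr01 x1)); move=> /ltW h; apply: le_trans h _.
  by rewrite -natrX ler_nat ltnW // ltn_expl.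
elim: n x => [|n IH] x x1 xT.
  have x0 : 0 < x by lra.
  have /andP[_ fx] := f_range x0; apply: le_trans fx _.
  have -> : - gamma + eps = - (gamma - eps) by ring.
  rewrite powRN ler_pdivlMr ?powR_gt0 // mul1r.
  apply: (@le_trans _ _ (x `^ gamma)); first by rewrite ler_powR //; lra.
  by rewrite ge0_ler_powR ?nnegrE //; lra.
have [xT'|xT'] := leP x (2 ^+ n * T2); first exact: IH.
have x2T : T <= x / 2.
  have : 1 * T2 <= 2 ^+ n * T2 by rewrite ler_wpM2r ?exprn_ege1 //; lra.
  by rewrite /T2 in xT' *; lra.
have /andP[_] := hT _ x2T; rewrite mulrCA divff // mulr1 => h; apply: le_trans h _.
have x20 : 1 <= x / 2 by lra.
have : f (x / 2) <= T2 `^ gamma * (x / 2) `^ (- gamma + eps).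
  by apply: IH => //; rewrite exprS -mulrA in xT; lra.
move=> /(ler_wpM2l (powR_ge0 2 (- gamma + eps))) h; apply: le_trans h _.
rewrite mulrCA -powRM //; last lra.
by rewrite mulrCA divff // mulr1.
Qed.

(** The same induction; on the initial interval [f] is at least its value at the right end, and the
    power is at most 1. *)
Lemma potter_lower (eps : R) : 0 < eps ->
  exists2 c : R, 0 < c & forall x, 1 <= x -> c * x `^ (- gamma - eps) <= f x.
Proof.
move=> e0; have [T T1 hT] := doubling e0; have [fdec _] := f_decr.
set T2 := 2 * T; have T20 : 1 <= T2 by rewrite /T2; lra.
have /andP[fT _] : 0 < f T2 <= 1 by apply: f_range; lra.
exists (f T2) => //.
suff main n x : 1 <= x -> x <= 2 ^+ n * T2 -> f T2 * x `^ (- gamma - eps) <= f x.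
  move=> x x1; apply: (main (Num.bound x)) => //.
  apply: (@le_trans _ _ (2 ^+ Num.bound x)); last by rewrite ler_peMr ?exprn_ge0.
  have := archi_boundP (ltW (lt_le_trans ltr01 x1)); move=> /ltW h; apply: le_trans h _.
  by rewrite -natrX ler_nat ltnW // ltn_expl.
elim: n x => [|n IH] x x1 xT.
  have x0 : 0 < x by lra.
  apply: (@le_trans _ _ (f T2)); last by apply: fdec; lra.
  have h : x `^ (- gamma - eps) <= x `^ 0 by rewrite ler_powR //; have := gamma_ge0; lra.
  by rewrite ler_piMr ?(ltW fT) // (le_trans h) // powRr0.
have [xT'|xT'] := leP x (2 ^+ n * T2); first exact: IH.
have x2T : T <= x / 2.
  have : 1 * T2 <= 2 ^+ n * T2 by rewrite ler_wpM2r ?exprn_ege1 //; lra.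
  by rewrite /T2 in xT' *; lra.
have /andP[+ _] := hT _ x2T; rewrite mulrCA divff // mulr1 => h; apply: le_trans h.
have x20 : 1 <= x / 2 by lra.
have : f T2 * (x / 2) `^ (- gamma - eps) <= f (x / 2).
  by apply: IH => //; rewrite exprS -mulrA in xT; lra.
move=> /(ler_wpM2l (powR_ge0 2 (- gamma - eps))) h; apply: le_trans h.
rewrite mulrCA -powRM //; last lra.
by rewrite [2 * _]mulrCA divff // mulr1.
Qed.

End Potter.

(** * Upper tail of the clique number *)

Section UpperTail.
Context {R : realType} (f : R -> R) (gamma : R).
Hypothesis f_range : forall x : R, 0 < x -> 0 < f x <= 1.
Hypothesis f_decr : decreases_to_zero f.
Hypothesis gamma_range : 0 <= gamma < 1.
Hypothesis f_rv : regularly_varying f (- gamma).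

Lemma f_nat01 (t : nat) : (0 < t)%N -> 0 <= f t%:R <= 1.
Proof. by move=> t0; have /andP[/ltW -> ->] := f_range (etrans (ltr0n R t) t0). Qed.

(** Each power of [s] is written as a nonnegative power, bounded by its value at [m], over [s]; the
    harmonic sum costs a logarithm, harmless here. *)
Lemma mean_nvert_le (C eps : R) (m : nat) : 0 <= C -> 0 <= eps ->
  (forall x, 1 <= x -> f x <= C * x `^ (- gamma + eps)) ->
  mean_nvert f m <= 1 + C * m%:R `^ (1 - gamma + eps) * (1 + ln m%:R).
Proof.
move=> C0 e0 fC; rewrite lerD2l.
apply: le_trans (ler_wpM2l _ (harmonic_le m)); last by rewrite mulr_ge0 ?powR_ge0.
rewrite mulr_sumr; apply: ler_sum => s _.
have s1 : 1 <= s.+1%:R :> R by rewrite ler1n.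
apply: le_trans (fC _ s1) _; rewrite -mulrA ler_wpM2l //.
rewrite ler_pdivlMr ?ltr0n // -[X in _ * X]powRr1 // -powR_add ?ltr0n //.
have -> : - gamma + eps + 1 = 1 - gamma + eps by ring.
have p0 : 0 <= 1 - gamma + eps by have /andP[] := gamma_range; lra.
by rewrite ge0_ler_powR ?nnegrE // ler_nat.
Qed.

Lemma late_sum_le (m n : nat) :
  \sum_(u < n) f (m + u).+1%:R / (m + u).+2%:R <= f m.+1%:R * (1 + ln n%:R).
Proof.
have [fdec _] := f_decr.
have fm : 0 <= f m.+1%:R by have /andP[] := f_nat01 (ltn0Sn m).
apply: le_trans (ler_wpM2l fm (harmonic_le n)).
rewrite mulr_sumr; apply: ler_sum => u _.
apply: ler_pM => //.
- by have /andP[] := f_nat01 (ltn0Sn (m + u)).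
- by apply: fdec; rewrite ?ltr0n // ler_nat; lia.
- by rewrite lef_pV2 ?posrE ?ltr0n // ler_nat; lia.
Qed.

Lemma upper_tail (delta : R) : 0 < delta < 1 ->
  exists2 C : R, 0 < C & forall t : nat, (2 <= t)%N ->
    expect f 0 t (fun g => (3 * t%:R `^ ((1 - gamma) * (1 + delta) / 2)
                              < (clique_number g)%:R)%R%:R) loop_graph <= C / ln t%:R.
Proof.
move=> /andP[d0 d1]; have /andP[g0 g1] := gamma_range.
(* The target exponent is [(1 - gamma) / 2 + 2 * eps]: one [eps] covers Potter's bound and the
   logarithm, the other is the gain. *)
pose eps := (1 - gamma) * delta / 4.
have e0 : 0 < eps by rewrite divr_gt0 ?mulr_gt0 ?subr_gt0.
have e1 : eps <= 1 / 4.
  have : (1 - gamma) * delta <= 1 * 1 by rewrite ler_pM //; lra.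
  by rewrite /eps; lra.
have [C C0 fC] := potter_upper f_range g0 f_rv e0.
pose A := 1 + (eps / 2)^-1.
have A0 : 0 < A by rewrite addr_gt0 // invr_gt0 divr_gt0.
pose B := 2 * C * A + 1.
have B0 : 0 < B by rewrite addr_gt0 // !mulr_gt0.
exists ((1 + C * A + 8 * B ^+ 2) * eps^-1).
  by rewrite mulr_gt0 ?invr_gt0 // addr_gt0 ?addr_gt0 ?mulr_gt0 ?exprn_gt0.
move=> t t2; set T : R := t%:R.
have T1 : 1 < T by rewrite /T ltr1n.
have T0 : 0 < T by lra.
(* The boundary between early and late births is the integer part of the square root of [t]. *)
have [m /andP[mT Tm]] : exists m : nat, m%:R <= T `^ (1 / 2) < m.+1%:R.
  by exists (Num.trunc (T `^ (1 / 2))); apply: truncn_itv; exact: powR_ge0.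
have sT1 : 1 <= T `^ (1 / 2) by apply: powR_ge1; lra.
have mt : (m <= t)%N.
  rewrite -(ler_nat R) (le_trans mT) // -[leRHS](powRr1 (ltW T0)).
  by apply: ler_powR; lra.
have logT n : (n <= t)%N -> 1 + ln n%:R <= A * T `^ (eps / 2).
  move=> nt; apply: le_trans (ln_le_powR (ltW T1) _); last by rewrite divr_gt0.
  by rewrite lerD2l ler_ln_nat.
set L := 3 * T `^ ((1 - gamma) * (1 + delta) / 2).
have LE : L = 3 * (T `^ ((1 - gamma) / 2 + eps) * T `^ eps).
  by rewrite /L -powR_add //; congr (_ * _ `^ _); rewrite /eps; field.
have L3 : 3 <= L.
  rewrite /L ler_peMr //; apply: powR_ge1; first exact: ltW.
  by rewrite divr_ge0 // mulr_ge0; lra.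
(* Potter's bound at [m + 1] and the logarithm contribute [eps / 2] each; the summand 1 in [B]
   ensures that [Theta] is at least the inverse of [m + 1]. *)
pose Theta := B * T `^ (- (gamma / 2) + eps).
have hmean : mean_nvert f m <= (1 + C * A) * T `^ ((1 - gamma) / 2 + eps).
  apply: le_trans (mean_nvert_le m (ltW C0) (ltW e0) fC) _.
  rewrite mulrDl mul1r lerD //; first by apply: powR_ge1; [exact: ltW|lra].
  have -> : (1 - gamma) / 2 + eps = (1 / 2) * (1 - gamma + eps) + eps / 2 by field.
  rewrite [in leRHS]powR_add // [in leRHS](powRrM T).
  have h1 : m%:R `^ (1 - gamma + eps) <= (T `^ (1 / 2)) `^ (1 - gamma + eps).
    by rewrite ge0_ler_powR ?nnegrE ?powR_ge0 //; lra.
  have h2 : 0 <= 1 + ln m%:R :> R by rewrite addr_ge0 ?ln_nat_ge0.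
  have h3 := ler_pM (powR_ge0 _ _) h2 h1 (logT m mt).
  by rewrite -mulrA (le_trans (ler_wpM2l (ltW C0) h3)) // le_eqVlt;
    apply/orP; left; apply/eqP; ring.
have M0 : 0 < m.+1%:R :> R by rewrite ltr0n.
have M2 : m.+1%:R <= 2 * T `^ (1 / 2) by rewrite -natr1; lra.
have hM : (m.+1%:R)^-1 <= T `^ (- (gamma / 2) + eps).
  apply: (@le_trans _ _ (T `^ (- (1 / 2)))).
    by rewrite powRN lef_pV2 ?posrE ?powR_gt0 // ltW.
  by apply: ler_powR; lra.
have hf : f m.+1%:R <= 2 * C * T `^ (- (gamma / 2) + eps / 2).
  have M1 : 1 <= m.+1%:R :> R by rewrite ler1n.
  apply: le_trans (fC _ M1) _; rewrite 2?powR_add //.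
  have h1 : m.+1%:R `^ (- gamma) <= T `^ (- (gamma / 2)).
    have -> : - (gamma / 2) = 1 / 2 * - gamma by field.
    by rewrite powRrM powR_le_anti ?powR_gt0 // ?(ltW Tm) //; lra.
  have h2 : m.+1%:R `^ eps <= 2 * T `^ (eps / 2).
    have -> : eps / 2 = 1 / 2 * eps by field.
    apply: (@le_trans _ _ ((2 * T `^ (1 / 2)) `^ eps)).
      have z0 : 0 <= 2 * T `^ (1 / 2) by rewrite mulr_ge0 ?powR_ge0.
      by apply: ge0_ler_powR; rewrite ?nnegrE // ltW.
    rewrite powRM ?powR_ge0 // -powRrM ler_wpM2r ?powR_ge0 //.
    by apply: ler1_powR; lra.
  have h3 := ler_pM (powR_ge0 _ _) (powR_ge0 _ _) h1 h2.
  apply: le_trans (ler_wpM2l (ltW C0) h3) _.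
  by rewrite le_eqVlt; apply/orP; left; apply/eqP; ring.
have hsum : \sum_(u < t - m) f (m + u).+1%:R / (m + u).+2%:R <= Theta.
  apply: le_trans (late_sum_le _ _) _.
  have f0 : 0 <= f m.+1%:R by have /andP[] := f_nat01 (ltn0Sn m).
  have l0 : 0 <= 1 + ln (t - m)%:R :> R by rewrite addr_ge0 ?ln_nat_ge0.
  apply: le_trans (ler_pM f0 l0 hf (logT _ (leq_subr _ _))) _.
  have -> : 2 * C * T `^ (- (gamma / 2) + eps / 2) * (A * T `^ (eps / 2)) =
    2 * C * A * T `^ (- (gamma / 2) + eps).
    have -> : - (gamma / 2) + eps = (- (gamma / 2) + eps / 2) + eps / 2 by field.
    by rewrite [in RHS]powR_add //; ring.
  by rewrite /Theta /B ler_wpM2r ?powR_ge0 //; lra.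
have hTheta : (m.+1%:R)^-1 <= Theta.
  apply: le_trans hM _; rewrite /Theta ler_peMl ?powR_ge0 // /B.
  by rewrite lerDr !mulr_ge0 // ltW.
have := expect_clique_gt f_nat01 hsum hTheta L3.
rewrite subnKC // => h; apply: (le_trans h).
have P0 : 0 < T `^ ((1 - gamma) / 2 + eps) by exact: powR_gt0.
have Q0 : 0 < T `^ eps by exact: powR_gt0.
have b1 : 3 / L * mean_nvert f m <= (1 + C * A) * T `^ (- eps).
  have L0 : 0 <= 3 / L by rewrite divr_ge0 //; lra.
  apply: le_trans (ler_wpM2l L0 hmean) _.
  rewrite LE powRN le_eqVlt; apply/orP; left; apply/eqP; field.
  by rewrite !gt_eqF.
have b2 : 36 * t.+1%:R * (Theta / L) ^+ 2 <= 8 * B ^+ 2 * T `^ (- eps).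
  have -> : Theta / L = B / 3 * T `^ (- (1 / 2) - eps).
    rewrite /Theta LE -powR_add //.
    have -> : T `^ (- (gamma / 2) + eps) =
      T `^ ((1 - gamma) / 2 + eps + eps) * T `^ (- (1 / 2) - eps).
      by rewrite -powR_add //; congr (_ `^ _); field.
    by field; rewrite gt_eqF // powR_gt0.
  have -> : (B / 3 * T `^ (- (1 / 2) - eps)) ^+ 2 = B ^+ 2 / 9 * (T `^ (-1) * T `^ (- eps) * T `^ (- eps)).
    rewrite exprMn expr2 [X in _ * X]expr2 -!powR_add //.
    have -> : - (1 / 2) - eps + (- (1 / 2) - eps) = -1 + - eps + - eps by field.
    by field.
  rewrite powR_inv1 ?(ltW T0) //.
  have q1 : T `^ (- eps) <= 1 by rewrite -[leRHS](powRr0 T) ler_powR ?ltW //; lra.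
  have q0 := powR_ge0 T (- eps).
  have tT : t.+1%:R <= 2 * T by rewrite -natr1 -/T; lra.
  apply: (@le_trans _ _ (36 * (2 * T) * (B ^+ 2 / 9 * (T^-1 * T `^ (- eps) * 1)))).
    have u0 : 0 <= T^-1 * T `^ (- eps) by rewrite mulr_ge0 // invr_ge0 ltW.
    have v0 : 0 <= B ^+ 2 / 9 by rewrite divr_ge0 ?sqr_ge0.
    apply: ler_pM.
    - by rewrite mulr_ge0.
    - by rewrite mulr_ge0 // mulr_ge0.
    - by rewrite ler_wpM2l.
    - by rewrite ler_wpM2l // ler_wpM2l.
  by rewrite le_eqVlt; apply/orP; left; apply/eqP; field; lra.
apply: (le_trans (lerD b1 b2)).
rewrite -mulrDl -mulrA ler_wpM2l ?powRN_le_ln //.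
by rewrite addr_ge0 ?addr_ge0 ?mulr_ge0 ?sqr_ge0 // ltW.
Qed.

End UpperTail.

(** * Lower tail of the clique number *)

Section LowerTail.
Context {R : realType} (f : R -> R) (gamma : R).
Hypothesis f_range : forall x : R, 0 < x -> 0 < f x <= 1.
Hypothesis f_decr : decreases_to_zero f.
Hypothesis gamma_range : 0 <= gamma < 1.
Hypothesis f_rv : regularly_varying f (- gamma).

Lemma mean_nvert_ge (m : nat) : (0 < m)%N -> m%:R * f m%:R <= mean_nvert f m.
Proof.
move=> m0; have [fdec _] := f_decr.
apply: (@le_trans _ _ (\sum_(s < m) f s.+1%:R)); last by rewrite lerDr.
rewrite mulr_natl -[leLHS](_ : \sum_(s < m) f m%:R = _).
  by apply: ler_sum => s _; apply: fdec; rewrite ?ltr0n // ler_nat.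
by rewrite sumr_const card_ord.
Qed.

Lemma mean_nvert_ge_powR (T a s c : R) (m : nat) :
  0 <= T -> 0 < c -> 0 <= s <= 1 -> (0 < m)%N -> T `^ a <= m.+1%:R ->
  (forall x, 1 <= x -> c * x `^ (s - 1) <= f x) ->
  c / 2 * T `^ (a * s) <= mean_nvert f m.
Proof.
move=> T0 c0 /andP[s0 s1] m0 Tm fc; apply: le_trans (mean_nvert_ge m0).
have m1 : 1 <= m%:R :> R by rewrite ler1n.
apply: (@le_trans _ _ (c * m%:R `^ s)).
  rewrite -mulrA ler_wpM2l ?(ltW c0) //.
  apply: (@le_trans _ _ ((2^-1 * T `^ a) `^ s)).
    rewrite powRM ?powR_ge0 ?invr_ge0 // powRrM ler_wpM2r ?powR_ge0 //.
    by apply: ger1_powR => //; lra.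
  have h0 : 0 <= 2^-1 * T `^ a by rewrite mulr_ge0 ?powR_ge0.
  apply: ge0_ler_powR; rewrite ?nnegrE //.
  by move: Tm; rewrite -natr1; lra.
apply: le_trans (ler_wpM2l (ler0n _ m) (fc _ m1)).
rewrite mulrCA ler_wpM2l ?(ltW c0) // -[X in _ <= X * _](powRr1 (ler0n _ m)).
rewrite -powR_add ?ltr0n // le_eqVlt; apply/orP; left; apply/eqP.
by congr (_ `^ _); ring.
Qed.

Lemma lower_tail (delta : R) : 0 < delta < 1 ->
  exists c C : R, [/\ 0 < c, 0 < C & exists t0 : nat,
  forall t : nat, (t0 <= t)%N ->
    expect f 0 t (fun g => ((clique_number g)%:R <
      c * t%:R `^ ((1 - gamma) * (1 - delta) / 2))%R%:R) loop_graph <= C / ln t%:R].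
Proof.
move=> /andP[d0 d1]; have /andP[g0 g1] := gamma_range.
(* The time [m] will be about [T ^ a], slightly below the square root. *)
pose a := (1 - delta / 2) / 2.
have a0 : 1 / 4 < a by rewrite /a; lra.
have a1 : a <= 1 / 2 by rewrite /a; lra.
have a00 : 0 <= a by lra.
(* [eta] bounds [f] after time [m] and is also the loss in the exponent of [r]; with [kappa] below,
   [q] is [T ^ (kappa - 1) / 8], which gives about [T ^ kappa] expected hits per pair. *)
pose eta := delta / 16.
have eta0 : 0 < eta <= 1 by rewrite /eta; lra.
have eta2 : eta <= 1 / 2 by rewrite /eta; lra.
pose kappa := delta / 4.
have kappa0 : 0 < kappa <= 1 by rewrite /kappa; lra.
pose s := (1 - gamma) * (1 - delta / 2).
have s0 : 0 < s by rewrite mulr_gt0 // subr_gt0 //; lra.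
have s1 : s <= 1.
  by rewrite /s -[leRHS]mul1r ler_pM //; lra.
(* The number of vertices at time [m] is at least of order [T ^ beta]; since
   [(1 - delta / 2) ^ 2 >= 1 - delta], this suffices. *)
pose beta := a * s.
have beta0 : 0 < beta by rewrite /beta mulr_gt0 //; lra.
have betaE : (1 - gamma) * (1 - delta) / 2 <= beta.
  have -> : beta = (1 - gamma) * (1 - delta) / 2 + (1 - gamma) * delta ^+ 2 / 8.
    by rewrite /beta /a /s; field.
  by rewrite lerDl !mulr_ge0 ?sqr_ge0 ?subr_ge0 // ltW.
have [c c0 fc] : exists2 c : R, 0 < c & forall x, 1 <= x -> c * x `^ (s - 1) <= f x.
  have e0 : 0 < (1 - gamma) * delta / 2 by rewrite divr_gt0 // mulr_gt0 ?subr_gt0.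
  have [c c0 fc] := potter_lower f_range f_decr g0 f_rv e0.
  exists c => // x /fc; suff -> : s - 1 = - gamma - (1 - gamma) * delta / 2 by [].
  by rewrite /s; field.
have [_ f0] := f_decr.
have [S0 [_ hS0]] := cvgr_lt _ f0 eta (andP eta0).1.
pose S1 := Num.max 1 S0.
have S11 : 1 <= S1 by rewrite le_max lexx.
have S10 : 0 <= S1 by lra.
have hS1 x : S1 < x -> f x < eta.
  by move=> Sx; apply: hS0; apply: le_lt_trans Sx; rewrite le_max lexx orbT.
pose K0 := (24 * (2 / kappa))^-1 `^ (- (2 / kappa)).
have K00 : 0 < K0.
  by rewrite powR_gt0 // invr_gt0 mulr_gt0 // divr_gt0 // (andP kappa0).1.
pose C1 := 8 / c; pose C2 := 16 * expR 1 : R; pose C3 := 4 * K0.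
have C10 : 0 < C1 by rewrite divr_gt0.
have C20 : 0 < C2 by rewrite mulr_gt0 ?expR_gt0.
have C30 : 0 < C3 by rewrite mulr_gt0.
have qE : - (2 * a) - 4 * eta = kappa - 1 by rewrite /a /eta /kappa; field.
have eta4 : 0 < eta / 2 by rewrite divr_gt0 // (andP eta0).1.
exists (c / 8), (C1 * beta^-1 + C2 * (eta / 2)^-1 + C3 * 1^-1); split.
- by rewrite divr_gt0.
- by rewrite !addr_gt0 ?(mulr_gt0 C10) ?(mulr_gt0 C20) ?(mulr_gt0 C30) ?invr_gt0.
(* The second bound gives [T ^ a >= S1], so that [f] is below [eta] after time [m]; the first leaves
   room for [4 * m <= t]. *)
exists (maxn 16 (Num.bound (S1 `^ a^-1))) => t; rewrite geq_max => /andP[t16 tS].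
set T : R := t%:R.
have T16 : 16 <= T by rewrite /T ler_nat.
have T1 : 1 < T by lra.
have T0 : 0 < T by lra.
have mS : S1 <= T `^ a.
  rewrite -[leLHS](powRr1 S10) -(@mulVf _ a) ?gt_eqF //; last lra.
  rewrite powRrM; apply: ge0_ler_powR; rewrite ?nnegrE ?powR_ge0 ?(ltW T0) //.
  apply: (@le_trans _ _ (Num.bound (S1 `^ a^-1))%:R); last by rewrite ler_nat.
  exact: ltW (archi_boundP (powR_ge0 _ _)).
have hq : T `^ (kappa - 1) / 8 = 1 / 2 * ((T `^ ((1 - a) / 2 - eta)) ^+ 2 / (2 * T)) ^+ 2.
  rewrite -qE.
  have -> : - (2 * a) - 4 * eta = ((1 - a) / 2 - eta) + ((1 - a) / 2 - eta) +
     (((1 - a) / 2 - eta) + ((1 - a) / 2 - eta)) + (-1 + -1) by field.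
  by rewrite !powR_add // powR_inv1 ?(ltW T0) //; field; lra.
have hL : 4 * (c / 8 * T `^ ((1 - gamma) * (1 - delta) / 2)) <= c / 2 * T `^ beta.
  apply: le_trans (ler_wpM2l (ltW (divr_gt0 c0 (ltr0Sn R 1))) (ler_powR (ltW T1) betaE)).
  by rewrite le_eqVlt; apply/orP; left; apply/eqP; field.
have Ta : T `^ a <= T `^ (1 / 2) by apply: ler_powR => //; exact: ltW.
have Ta1 : 1 <= T `^ a by apply: powR_ge1 => //; exact: ltW.
have Tsq : T `^ (1 / 2) * T `^ (1 / 2) = T.
  by rewrite -powR_add // -[RHS](powRr1 (ltW T0)); congr (_ `^ _); field.
have T4 : T `^ (1 / 2) <= T / 4.
  by apply: le_quarter_sqr => //; exact: powR_ge0.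
have s01 : 0 <= s <= 1 by rewrite s1 ltW.
have q01 : 0 <= T `^ (kappa - 1) / 8 <= 1.
  rewrite divr_ge0 ?powR_ge0 //= ler_pdivrMr // mul1r.
  apply: le_trans (_ : T `^ 0 <= _); last by rewrite powRr0 ler1n.
  by apply: ler_powR; [exact: ltW|rewrite subr_le0; case/andP: kappa0].
have [m /andP[mT Tm]] : exists m : nat, m%:R <= T `^ a < m.+1%:R.
  by exists (Num.trunc (T `^ a)); apply: truncn_itv; exact: powR_ge0.
have m0 : (0 < m)%N by rewrite -ltnS -(ltr_nat R) (le_lt_trans Ta1).
have M2 : m.+1%:R <= 2 * T `^ a.
  by rewrite -natr1 mulr_natl mulr2n lerD.
have mt4 : (4 * m <= t)%N.
  rewrite -(ler_nat R) natrM -/T mulrC -ler_pdivlMr //.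
  exact: le_trans mT (le_trans Ta T4).
have [n1 [n2 [tE n1T n2T]]] := split_time t16 mt4.
have {}n1T : T / 2 <= (m + n1)%:R by rewrite ler_pdivrMr // mulrC -natrM ler_nat.
have {}n2T : T / 3 <= n2%:R by rewrite ler_pdivrMr // mulrC -natrM ler_nat.
have feta u : (m < u)%N -> f u%:R <= eta.
  move=> mu; apply/ltW/hS1; apply: (@lt_le_trans _ _ m.+1%:R); last by rewrite ler_nat.
  exact: le_lt_trans Tm.
have hw u : (u < n1)%N -> weight m ((1 - eta) / 2) u.+1 *
     (1 - (1 - eta) / (2 * (m + u).+1%:R) + ((m + u).+1%:R ^+ 2)^-1) <=
     weight m ((1 - eta) / 2) u.
  move=> _; rewrite invfM mulrA; apply: weight_step => //.
  by rewrite divr_ge0 // subr_ge0; case/andP: eta0.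
have hF := mean_nvert_ge_powR (ltW T0) c0 s01 m0 (ltW Tm) fc.
have hq' : T `^ (kappa - 1) / 8 <=
    1 / 2 * ((T `^ ((1 - a) / 2 - eta)) ^+ 2 / (2 * (m + n1 + n2)%:R)) ^+ 2.
  by rewrite tE -/T hq.
have := expect_clique_lt (f_nat01 f_range) (powR_gt0 _ T0) eta2 feta
  (weight_gt0 _ _) hw q01 hq' (le_trans hL hF).
rewrite tE -/T => h; apply: (le_trans h).
rewrite [leRHS]mulrDl [X in _ <= X + _]mulrDl; apply: lerD; first apply: lerD.
- have E : C1 * beta^-1 / ln T = C1 * (beta^-1 / ln T) by rewrite mulrA.
  rewrite E; apply: le_trans (ler_wpM2l (ltW C10) (powRN_le_ln T1 beta0)).
  have Fl : 0 < c / 2 * T `^ beta by rewrite mulr_gt0 ?divr_gt0 ?powR_gt0.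
  apply: (@le_trans _ _ (4 / (c / 2 * T `^ beta))).
    by rewrite ler_wpM2l // lef_pV2 ?posrE // (lt_le_trans Fl).
  rewrite powRN le_eqVlt; apply/orP; left; apply/eqP; rewrite /C1; field.
  by rewrite !gt_eqF ?powR_gt0.
- have E : C2 * (eta / 2)^-1 / ln T = C2 * ((eta / 2)^-1 / ln T) by rewrite mulrA.
  rewrite E; apply: le_trans (ler_wpM2l (ltW C20) (powRN_le_ln T1 eta4)).
  exact: degree_term_le.
- have E : C3 * 1^-1 / ln T = C3 * (1^-1 / ln T) by rewrite mulrA.
  rewrite E; apply: le_trans (ler_wpM2l (ltW C30) (powRN_le_ln T1 ltr01)).
  by have := pairs_term_le T1 a1 kappa0 M2 n2T; rewrite -/K0.
Qed.

End LowerTail.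

(** * The law of the process *)

Local Open Scope classical_set_scope.
Local Open Scope ring_scope.

Lemma step_prob_ge0 (R : realType) b (g h : mgraph) : 0 <= step_prob R b g h.
Proof.
by rewrite /step_prob; case: b; apply: sumr_ge0 => u _; rewrite ?sumr_ge0 // => *;
  rewrite ?mulr_ge0 ?pi_deg_ge0.
Qed.

Lemma sum_delta (R : realType) (I : eqType) (s : seq I) (x : I) (psi : I -> R) :
  uniq s -> x \in s -> \sum_(h <- s) (x == h)%:R * psi h = psi x.
Proof.
move=> us xs; rewrite (bigD1_seq x) //= eqxx mul1r big1 ?addr0 // => h.
by rewrite eq_sym => /negbTE ->; rewrite mul0r.
Qed.

(** A finite list carrying the law of the next graph; [undup] provides the uniqueness used in
    [sum_delta] and [sum_preimage_le]. *)
Definition successors (b : bool) (g : mgraph) : seq mgraph :=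
  undup (if b then [seq add_vertex v | v : 'I_(nvert g)]
         else [seq add_edge u v | u <- enum 'I_(nvert g), v <- enum 'I_(nvert g)]).

(** Links the operator, a sum over random choices, to the transition kernel of the process: each
    choice leads to exactly one successor. *)
Lemma avg_step_prob (R : realType) (x : R) (psi : mgraph -> R) (g : mgraph) :
  avg x psi g =
  x * (\sum_(h <- successors true g) step_prob R true g h * psi h) +
  (1 - x) * (\sum_(h <- successors false g) step_prob R false g h * psi h).
Proof.
rewrite /avg; congr (_ * _ + _ * _); rewrite /step_prob; symmetry.
- under eq_bigr do rewrite mulr_suml.
  rewrite exchange_big /=; apply: eq_bigr => v _.
  under eq_bigr do rewrite -mulrA.
  rewrite -mulr_sumr sum_delta ?undup_uniq // mem_undup.
  by apply/mapP; exists v => //; rewrite mem_enum.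
- under eq_bigr do rewrite mulr_suml.
  rewrite exchange_big /=; apply: eq_bigr => u _.
  under eq_bigr do rewrite mulr_suml.
  rewrite exchange_big /=; apply: eq_bigr => v _.
  under eq_bigr do rewrite -mulrA.
  rewrite -mulr_sumr sum_delta ?undup_uniq // mem_undup.
  by apply/allpairsP; exists (u, v); rewrite !mem_enum.
Qed.

Section Law.
Context {R : realType} (f : R -> R) (d : measure_display).
Context (T : measurableType d) (P : probability T R).
Context (Z : nat -> {RV P >-> bool}) (G : nat -> {RV P >-> mgraph}).
Hypothesis f01 : forall t : nat, (0 < t)%N -> 0 <= f t%:R <= 1.
Hypothesis process : edge_step_process f Z G.

Lemma measurable_preimage_graph n (S : set mgraph) : measurable (G n @^-1` S).
Proof. by rewrite -[X in measurable X]setTI; exact: measurable_funP. Qed.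

Lemma measurable_preimage_bool n (S : set bool) : measurable (Z n @^-1` S).
Proof. by rewrite -[X in measurable X]setTI; exact: measurable_funP. Qed.

Lemma history0 z g : history Z G z g 0 = G 0%N @^-1` [set g 0%N].
Proof.
rewrite /history; apply/seteqP; split => w /=; first by case=> _ ->.
by move=> h; split=> s hs; [lia|have -> : s = 0%N by lia].
Qed.

Lemma historyS z g t : history Z G z g t.+1 =
  history Z G z g t `&` Z t.+1 @^-1` [set z t.+1] `&` G t.+1 @^-1` [set g t.+1].
Proof.
rewrite /history; apply/seteqP; split => w /=.
  move=> [hZ hG]; split; last exact: hG.
  split; last by apply: hZ; lia.
  by split=> s hs; [apply: hZ|apply: hG]; lia.
move=> [[[hZ hG] hz] hg]; split=> s hs.
  by have [-> //|ne] := eqVneq s t.+1; apply: hZ; lia.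
by have [-> //|ne] := eqVneq s t.+1; apply: hG; lia.
Qed.

Lemma measurable_history z g t : measurable (history Z G z g t).
Proof.
elim: t => [|t IH]; first by rewrite history0; exact: measurable_preimage_graph.
rewrite historyS; apply: measurableI; last exact: measurable_preimage_graph.
by apply: measurableI => //; exact: measurable_preimage_bool.
Qed.

Lemma sum_preimage_le n (s : seq mgraph) (A : set T) : uniq s -> measurable A ->
  (\sum_(h <- s) P (A `&` G n @^-1` [set h]) <= P A)%E.
Proof.
elim: s A => [|h s IH] A us mA; first by rewrite big_nil.
move: us => /= /andP[hs us]; rewrite big_cons.
have mh := measurable_preimage_graph n [set h].
rewrite [leRHS](measureDI P mA mh) addeC leeD2r //.
apply: le_trans (IH (A `\` G n @^-1` [set h]) us _); last exact: measurableD.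
rewrite big_seq [leRHS]big_seq le_eqVlt; apply/orP; left; apply/eqP.
apply: eq_bigr => h' h's; congr (P _); apply/seteqP; split => w /=.
  by move=> [wA wh]; split=> //; split=> // wh'; move: hs; rewrite -wh' wh h's.
by move=> [[wA _] wh].
Qed.

Lemma prob_Z t b : P (Z t.+1 @^-1` [set b]) =
  (if b then f t.+1%:R else 1 - f t.+1%:R)%:E.
Proof.
case: b; first exact: (esp_bernoulli process).
have -> : Z t.+1 @^-1` [set false] = ~` (Z t.+1 @^-1` [set true]).
  apply/seteqP; split => w /=; first by move=> ->.
  by case: (Z t.+1 w).
rewrite probability_setC; last exact: measurable_preimage_bool.
by rewrite (esp_bernoulli process).
Qed.

(* Only finite additivity over the successors of g t is used; this is why an
   inequality, which suffices, is stated. *)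
Lemma prob_ge_expect_history (S : pred mgraph) k t z g :
  (P (history Z G z g t) * (expect f t k (fun h => (S h)%:R) (g t))%:E <=
   P (history Z G z g t `&` G (t + k)%N @^-1` [set h | S h]))%E.
Proof.
elim: k t z g => [|k IH] t z g.
  rewrite addn0 /=; case: (boolP (S (g t))) => Sg.
    rewrite mule1 le_eqVlt; apply/orP; left; apply/eqP; congr (P _).
    apply/seteqP; split => w /=; last by case.
    by move=> hw; split=> //; case: hw => _ /(_ _ (leqnn t)) ->.
  by rewrite mule0.
set H := history Z G z g t; set E := G _ @^-1` _.
have mH : measurable H := measurable_history z g t.
have mE : measurable E by exact: measurable_preimage_graph.
have mB b : measurable (Z t.+1 @^-1` [set b]) by exact: measurable_preimage_bool.
set psi := fun h : mgraph => (S h)%:R : R.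
have key b : ((P H * (if b then f t.+1%:R else 1 - f t.+1%:R)%:E) *
    (\sum_(h <- successors b (g t)) step_prob R b (g t) h *
        expect f t.+1 k psi h)%:E <= P (H `&` E `&` Z t.+1 @^-1` [set b]))%E.
  apply: le_trans (sum_preimage_le t.+1 (undup_uniq _) (measurableI _ _
    (measurableI _ _ mH mE) (mB b))).
  rewrite -prob_Z -(esp_indep process) -sumEFin ge0_sume_distrr.
    apply: lee_sum => h _; rewrite EFinM muleA -(esp_step process).
    (* Overriding both sequences at time [t + 1] turns the refined event into a longer history, for
       the induction hypothesis. *)
    pose z' s := if s == t.+1 then b else z s.
    pose g' s := if s == t.+1 then h else g s.
    have := IH t.+1 z' g'; rewrite historyS /z' /g' !eqxx.
    have -> : history Z G (fun s => if s == t.+1 then b else z s)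
                 (fun s => if s == t.+1 then h else g s) t = H.
      rewrite /H /history; apply/seteqP; split => w [hZ hG]; split=> s hs.
      - by rewrite hZ //; case: eqP => // ?; lia.
      - by rewrite hG //; case: eqP => // ?; lia.
      - by rewrite hZ //; case: eqP => // ?; lia.
      - by rewrite hG //; case: eqP => // ?; lia.
    move=> h1; apply: (le_trans h1); apply: le_measure.
    - rewrite inE; apply: measurableI; last exact: measurable_preimage_graph.
      by apply: measurableI; [exact: measurableI|exact: measurable_preimage_graph].
    - rewrite inE; apply: measurableI; last exact: measurable_preimage_graph.
      by apply: measurableI => //; exact: measurableI.
    - by rewrite /E addSnnS => w /= [[[? ?] ?] ?].
  move=> h _; rewrite lee_fin mulr_ge0 ?step_prob_ge0 //.
  by apply: (expect_ge0 f01) => h'.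
have /andP[f0 f1] := f01 (ltn0Sn t).
rewrite [leRHS](measureDI P (measurableI _ _ mH mE) (mB false)).
have -> : H `&` E `\` Z t.+1 @^-1` [set false] = H `&` E `&` Z t.+1 @^-1` [set true].
  rewrite setDE; congr (_ `&` _); apply/seteqP; split => w /=;
    by case: (Z t.+1 w).
apply: le_trans (leeD (key true) (key false)).
rewrite /= avg_step_prob -/psi EFinD !EFinM ge0_muleDr ?muleA //.
- rewrite mule_ge0 ?lee_fin // sumr_ge0 // => h _.
  by rewrite mulr_ge0 ?step_prob_ge0 //; apply: (expect_ge0 f01) => h'.
- rewrite mule_ge0 ?lee_fin ?subr_ge0 // sumr_ge0 // => h _.
  by rewrite mulr_ge0 ?step_prob_ge0 //; apply: (expect_ge0 f01) => h'.
Qed.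

Lemma prob_ge_expect (S : pred mgraph) n :
  ((expect f 0 n (fun h => (S h)%:R) loop_graph)%:E <=
   P (G n @^-1` [set h | S h]))%E.
Proof.
have := prob_ge_expect_history S n 0 (fun=> true) (fun=> loop_graph).
have -> : history Z G (fun=> true) (fun=> loop_graph) 0 = setT.
  by rewrite history0; apply/seteqP; split => w //= _; exact: (esp_start process).
by rewrite probability_setT mul1e setTI add0n.
Qed.

End Law.

(** * Combination of the two tails *)

Theorem theorem2 (R : realType) (f : R -> R) (gamma : R)
    (f_range : forall x : R, 0 < x -> 0 < f x <= 1)
    (f_decr : decreases_to_zero f)
    (gamma_range : 0 <= gamma < 1)
    (f_rv : regularly_varying f (- gamma))
    (delta : R) (delta_range : 0 < delta < 1) :
  exists c1 c2 c3 : R, [/\ 0 < c1, 0 < c2, 0 < c3 &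
    forall (d : measure_display) (T : measurableType d) (P : probability T R)
      (Z : nat -> {RV P >-> bool}) (G : nat -> {RV P >-> mgraph}),
      edge_step_process f Z G ->
      forall t : nat, (2 <= t)%N ->
        ((1 - c3 / ln t%:R)%:E <=
         P [set w | (c1 * t%:R `^ ((1 - gamma) * (1 - delta) / 2)
                      <= (clique_number (G t w))%:R
                      <= c2 * t%:R `^ ((1 - gamma) * (1 + delta) / 2))%R])%E].
Proof.
have [CU CU0 hU] := upper_tail f_range f_decr gamma_range f_rv delta_range.
have [c [CL [c0 CL0 [t0 hL]]]] := lower_tail f_range f_decr gamma_range f_rv delta_range.
have f01 := f_nat01 f_range.
(* For [t < t0] this exceeds [ln t], so the claimed lower bound is at most 0. *)
pose C0 : R := ln (t0.+1)%:R + 1.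
have lt0 := @ln_nat_ge0 R t0.+1.
have C00 : 0 < C0 by rewrite /C0; lra.
exists c, 3, (CU + CL + C0); split => //; first by rewrite addr_gt0 // addr_gt0.
move=> d T P Z G process t t2.
have l0 : 0 < ln t%:R :> R by rewrite ln_gt0 // ltr1n.
have [tt0|t0t] := ltnP t t0.
  apply: (@le_trans _ _ 0%E); last exact: measure_ge0.
  rewrite lee_fin subr_le0 ler_pdivlMr // mul1r.
  have := @ler_ln_nat R t t0.+1 (leqW (ltnW tt0)).
  by rewrite /C0; lra.
set lo := c * _; set hi := 3 * _.
pose S : pred mgraph := fun g => lo <= (clique_number g)%:R <= hi.
apply: le_trans (prob_ge_expect f01 process S t).
rewrite lee_fin.
have rl := reachable_loop.
(* Union bound: the indicator of the event is at least 1 minus the indicators of the two tails. *)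
apply: (@le_trans _ _ (expect f 0 t (fun g => 1 +
   (-1 * (hi < (clique_number g)%:R)%R%:R + -1 * ((clique_number g)%:R < lo)%R%:R)) loop_graph)).
  rewrite expectD (expect_cst f _ _ rl) expectD !expectZ.
  have := hU t t2; have := hL t t0t; rewrite -/lo -/hi => h1 h2.
  have h3 : 0 <= C0 / ln t%:R by rewrite divr_ge0 // ltW.
  rewrite [(_ + C0) / _]mulrDl [(CU + CL) / _]mulrDl !mulN1r.
  move: h1 h2 h3; set x := expect _ _ _ _ _; set y := expect _ _ _ _ _.
  set a := CU / _; set b := CL / _; set e := C0 / _.
  by clearbody x y a b e; lra.
apply: (ler_expect f01 rl (extends_refl _)) => g _ _; rewrite /S.
by case: leP => _; case: leP => _ /=; lra.
Qed.
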